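(* Let $F:\mathbb{R}^n\times\mathbb{R}\to\mathbb{R}$ be a globally definable function of class $C^{2+m}$ over a polynomially bounded o-minimal structure, $m$ a non-negative integer, such that $0$ is a regular value of $F$; let $M=F^{-1}(0)$ and $\mathbf{t}_M:M\to\mathbb{R}$, $(\mathbf{x},t)\mapsto t$. Let $c$ be a value taken by $\mathbf{t}_M$ which is not a generalized critical value. Then $\mathbf{t}_M$ is horizontally spherical at $c$ at infinity. In particular, for a regular value $c$ taken by $\mathbf{t}_M$, $t$-equisingularity at infinity at $c$ of the family $\{T_t\}_{t\in\mathbb{R}}$ implies that $\mathbf{t}_M$ is horizontally spherical at $c$ at infinity.
   Context: Fix a polynomially bounded o-minimal structure $\mathcal{M}$ expanding the real field; ''definable'' means definable in $\mathcal{M}$. A subset of $\mathbb{R}^q$ is globally definable if its image under $\mathbf{x}\mapsto \mathbf{x}/\sqrt{1+|\mathbf{x}|^2}$ is definable; a mapping is globally definable if its graph is. Here $n\ge 1$. Write $\nabla F=\partial_{\mathbf{x}}F+\partial_tF\,\partial_t$ with $\partial_{\mathbf{x}}F\in\mathbb{R}^n\times 0$; on $M$ let $\nu_M=\nabla F/|\nabla F|$ and $\nu_M^{\mathbf{x}}=\partial_{\mathbf{x}}F/|\nabla F|$. $M$ carries the metric induced from $\mathbb{R}^{n+1}$; the gradient of $\mathbf{t}_M$ satisfies $|\nabla\mathbf{t}_M|=|\partial_{\mathbf{x}}F|/|\nabla F|$. Put $T_t=\{\mathbf{x}\in\mathbb{R}^n:(\mathbf{x},t)\in M\}$. The critical locus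 is $\mathrm{crit}(\mathbf{t}_M)=\{\mathbf{p}\in M:\partial_{\mathbf{x}}F(\mathbf{p})=0\}$ and $K_0(\mathbf{t}_M)=\mathbf{t}_M(\mathrm{crit}(\mathbf{t}_M))$; a regular value is one not in $K_0(\mathbf{t}_M)$. Malgrange condition at $c\in\mathbb{R}$: there are positive constants $R,\varepsilon,A_c$ such that for $(\mathbf{x},t)\in M$, $|\mathbf{x}|>R$ and $|t-c|<\varepsilon$ imply $|\mathbf{x}|\cdot|\nabla\mathbf{t}_M(\mathbf{x},t)|\ge A_c$. $K_\infty(\mathbf{t}_M)$ is the set of $c\in\mathbb{R}$ at which the Malgrange condition fails (asymptotic critical values). The set of generalized critical values is $K(\mathbf{t}_M)=K_0(\mathbf{t}_M)\cup K_\infty(\mathbf{t}_M)$. Spherical compactification: $\overline{\mathbb{R}^n}=\mathbb{R}^n\sqcup\mathbf{S}^{n-1}_\infty$, where $\mathbf{x}_k\to\mathbf{u}\in\mathbf{S}^{n-1}_\infty=\mathbf{S}^{n-1}$ means $|\mathbf{x}_k|\to\infty$ and $\mathbf{x}_k/|\mathbf{x}_k|\to\mathbf{u}$. $\overline{M}$ is the closure of $M$ in $\overline{\mathbb{R}^n}\times\mathbb{R}$ and $M^\infty=\overline{M}\cap(\mathbf{S}_\infty^{n-1}\times\mathbb{R})$. Horizontal sphericalness: for a regular value $c$ taken by $\mathbf{t}_M$, $\mathbf{t}_M$ is horizontally spherical at $c$ at infinity if for every sequence $(\mathbf{p}_k)_k$ of $M$ converging to some $(\mathbf{u},c)\in M^\infty$,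 every accumulation value $\mathbf{v}$ of $\nu_M^{\mathbf{x}}(\mathbf{p}_k)/|\nu_M^{\mathbf{x}}(\mathbf{p}_k)|$ satisfies $\langle\mathbf{v},\mathbf{u}\rangle=0$. $t$-equisingularity: let $\mathbf{G}^\vee(1,n+1)$ be the space of lines in the space of linear forms on $\mathbb{R}^{n+1}$. Let $\mathbf{r}_M:M\to\mathbb{R}$, $(\mathbf{x},t)\mapsto|\mathbf{x}|$, and at a regular point $\mathbf{p}$ of $\mathbf{r}_M$ (with $\mathbf{x}\neq0$) let $T_{\mathbf{p}}\mathbf{r}_M\subset T_{\mathbf{p}}M$ be the tangent space to the level of $\mathbf{r}_M$ through $\mathbf{p}$. The space $\mathscr{C}(M)$ of characteristic covectors at infinity is the part lying over $M^\infty$ of the closure, in $\overline{\mathbb{R}^n}\times\mathbb{R}\times\mathbf{G}^\vee(1,n+1)$, of $\{(\mathbf{p},\xi):\mathbf{p}\in M \text{ a regular point of }\mathbf{r}_M,\ \xi(T_{\mathbf{p}}\mathbf{r}_M)=0\}$; $\mathscr{C}(M)_{\mathbf{p}}$ is its fibre over $\mathbf{p}\in M^\infty$. Let $\tau(\mathbf{x},t)=t$; its relative conormal space at infinity $(\mathscr{X}_\tau^\infty)_{\mathbf{p}}$ consists of the single covector line whose kernel is $\mathbb{R}^n\times 0$. The family $\{T_t\}_{t\in\mathbb{R}}$ is $t$-equisingular at $\mathbf{p}\in M^\infty$ if $\mathscr{C}(M)_{\mathbf{p}}\cap(\mathscr{X}_\tau^\infty)_{\mathbf{p}}=\emptyset$,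 and it is $t$-equisingular at infinity at $c$ if it is $t$-equisingular at every $\mathbf{p}\in M^\infty\cap\tau^{-1}(c)$. *)

(* Defs.v *)
From HB Require Import structures.
From mathcomp Require Import all_boot all_order all_algebra.
From mathcomp Require Import all_classical all_reals all_analysis.
From mathcomp Require Import ring lra.
Set Implicit Arguments.
Unset Strict Implicit.
Unset Printing Implicit Defensive.
Import Order.TTheory GRing.Theory Num.Theory.
Import numFieldNormedType.Exports.
Local Open Scope classical_set_scope.
Local Open Scope ring_scope.
Local Open Scope quotient_scope.

(* The library norm of 'rV[R]_n is the sup norm and that of a product is the
   max norm; [enorm] and [enorm1] are the Euclidean norms of R^n and of
   R^(n+1) = R^n x R.  They induce the same topology. *)
Section euclidean.
Context {R : realType} {n : nat}.
Implicit Types (u v : 'rV[R]_n) (p q : 'rV[R]_n * R).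

Definition dot u v : R := \sum_(i < n) u 0 i * v 0 i.
Definition enorm u : R := Num.sqrt (dot u u).

Definition dot1 p q : R := dot p.1 q.1 + p.2 * q.2.
Definition enorm1 p : R := Num.sqrt (dot1 p p).

Definition ball_map u : 'rV[R]_n := (Num.sqrt (1 + enorm u ^+ 2))^-1 *: u.

End euclidean.

(* o-minimal structures expanding the real field, presented by their families
   of definable (with parameters) sets. *)
Record omin_structure (R : realType) := OminStructure {
  definable : forall q, set (set 'rV[R]_q) ;
  definable0 : forall q, definable (@set0 'rV[R]_q) ;
  definableU : forall q (A B : set 'rV[R]_q),
    definable A -> definable B -> definable (A `|` B) ;
  definableC : forall q (A : set 'rV[R]_q), definable A -> definable (~` A) ;
  definable_diag : forall q (i j : 'I_q),
    definable [set x : 'rV[R]_q | x 0 i = x 0 j] ;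
  definableXR : forall q (A : set 'rV[R]_q), definable A ->
    definable [set x : 'rV[R]_(q + 1) | A (lsubmx x)] ;
  definableRX : forall q (A : set 'rV[R]_q), definable A ->
    definable [set x : 'rV[R]_(1 + q) | A (rsubmx x)] ;
  definable_proj : forall q (A : set 'rV[R]_(q + 1)), definable A ->
    definable [set lsubmx x | x in A] ;
  definable_add : definable [set x : 'rV[R]_3 | x 0 0 + x 0 1 = x 0 2%R] ;
  definable_mul : definable [set x : 'rV[R]_3 | x 0 0 * x 0 1 = x 0 2%R] ;
  definable1 : forall A : set 'rV[R]_1, definable A <->
    exists s : seq (interval R),
      A = [set x : 'rV[R]_1 | exists2 I, I \in s & x 0 0 \in I] }.

Definition polynomially_bounded (R : realType) (S : omin_structure R) :=
  forall f : R -> R, definable S [set x : 'rV[R]_2 | x 0 1 = f (x 0 0)] ->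
    exists N : nat, \forall t \near +oo, `|f t| <= t ^+ N.

Definition globally_definable (R : realType) (S : omin_structure R) q
  (A : set 'rV[R]_q) := definable S (ball_map @` A).

Definition globally_definable_fun (R : realType) (S : omin_structure R) n
    (F : 'rV[R]_n * R -> R) :=
  globally_definable S
    [set (row_mx (row_mx p.1 (const_mx p.2)) (const_mx (F p))
            : 'rV[R]_(n + 1 + 1)) | p in [set: 'rV[R]_n * R]].

Fixpoint of_class (R : realType) (V : normedModType R) (k : nat)
    (f : V -> R) : Prop :=
  if k is k'.+1 then
    (forall p, differentiable f p) /\ forall v, of_class k' ('D_v f)
  else continuous f.

Section hypersurface.
Context {R : realType} {n : nat}.
Variable F : 'rV[R]_n * R -> R.
Implicit Types (p w : 'rV[R]_n * R) (c : R).

Definition dF_x p : 'rV[R]_n := \row_i 'D_(delta_mx 0 i, 0) F p.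
Definition dF_t p : R := 'D_(0, 1) F p.
Definition nabla p : 'rV[R]_n * R := (dF_x p, dF_t p).

Definition regular_value_of (a : R) := forall p, F p = a -> nabla p != 0.

Definition hsurf : set ('rV[R]_n * R) := F @^-1` [set 0].

Definition nu p : 'rV[R]_n * R := (enorm1 (nabla p))^-1 *: nabla p.
Definition nu_x p : 'rV[R]_n := (nu p).1.

Definition tangent p : set ('rV[R]_n * R) := [set w | 'D_w F p = 0].

(* gradient of the restriction of t to the hypersurface: the orthogonal
   projection of d/dt onto the tangent space, see [grad_tP] and
   [enorm1_grad_t] *)
Definition grad_t p : 'rV[R]_n * R := (0, 1) - dot1 (0, 1) (nu p) *: nu p.

Definition values_t : set R := snd @` hsurf.
Definition crit_t : set ('rV[R]_n * R) := [set p | hsurf p /\ dF_x p = 0].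
Definition K0 : set R := snd @` crit_t.

Definition malgrange c :=
  exists rho eps A : R, [/\ 0 < rho, 0 < eps & 0 < A] /\
    forall p, hsurf p -> rho < enorm p.1 -> `|p.2 - c| < eps ->
      A <= enorm p.1 * enorm1 (grad_t p).
Definition Kinf : set R := [set c | ~ malgrange c].
Definition K : set R := K0 `|` Kinf.

End hypersurface.

Section gradient.
Context {R : realType} {n : nat}.
Variables (F : 'rV[R]_n * R -> R) (p : 'rV[R]_n * R).
Implicit Types q w : 'rV[R]_n * R.

Lemma derive_nabla w : differentiable F p -> 'D_w F p = dot1 (nabla F p) w.
Proof.
move=> dF; rewrite deriveE//.
have ew : w = \sum_(i < n) w.1 0 i *: (delta_mx 0 i, 0) + w.2 *: (0, 1).
  have -> : \sum_(i < n) w.1 0 i *: (delta_mx 0 i, 0) = (w.1, 0) :> 'rV[R]_n * R.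
    rewrite [in RHS](row_sum_delta w.1).
    rewrite (big_morph (fun v : 'rV[R]_n => (v, 0 : R))
      (id1 := 0) (op1 := +%R))// => [|u v].
      by apply: eq_bigr => i _; congr (_, _); rewrite scaler0.
    by congr (_, _); rewrite addr0.
  case: (w) => w1 w2; congr (_, _) => /=; first by rewrite scaler0 addr0.
  by rewrite add0r; exact/esym/mulr1.
rewrite [in LHS]ew linearD linearZ linear_sum /= -deriveE// /dot1 /=; congr (_ + _).
  by apply: eq_bigr => i _; rewrite linearZ /= -deriveE// mxE mulrC.
by rewrite /dF_t mulrC.
Qed.

Hypothesis dF0 : nabla F p != 0.

Let dot1C q w : dot1 q w = dot1 w q.
Proof.
rewrite /dot1 [q.2 * _]mulrC; congr (_ + _).
by apply: eq_bigr => i _; rewrite mulrC.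
Qed.

Let dot1D q q' w : dot1 (q + q') w = dot1 q w + dot1 q' w.
Proof.
rewrite /dot1 /= /dot addrACA -mulrDl -big_split /=; congr (_ + _).
by apply: eq_bigr => i _; rewrite mxE mulrDl.
Qed.

Let dot1Z a q w : dot1 (a *: q) w = a * dot1 q w.
Proof.
rewrite /dot1 /= mulrDr mulrA; congr (_ + _).
by rewrite mulr_sumr; apply: eq_bigr => i _; rewrite mxE mulrA.
Qed.

Let dot1_ge0 q : 0 <= dot1 q q.
Proof.
apply: addr_ge0; last by rewrite -expr2 sqr_ge0.
by apply: sumr_ge0 => i _; rewrite -expr2 sqr_ge0.
Qed.

Let nabla_gt0 : 0 < dot1 (nabla F p) (nabla F p).
Proof.
rewrite lt0r dot1_ge0 andbT; apply: contra dF0.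
rewrite /dot1 paddr_eq0 -?expr2 ?sqr_ge0 ?sqrf_eq0 => //; last first.
  by apply: sumr_ge0 => i _; rewrite -expr2 sqr_ge0.
move=> /andP[]; rewrite psumr_eq0 => [/allP h /eqP t0|j _]; last first.
  by rewrite -expr2 sqr_ge0.
apply/eqP; rewrite [LHS]surjective_pairing t0; congr (_, _).
apply/rowP => i; rewrite [RHS]mxE; apply/eqP; rewrite -sqrf_eq0.
exact: h i (mem_index_enum i).
Qed.

Let et w : dot1 (0, 1) w = w.2.
Proof.
rewrite /dot1 /= mul1r /dot big1 ?add0r// => i _.
by rewrite mxE mul0r.
Qed.

Lemma grad_tP : differentiable F p ->
  tangent F p (grad_t F p) /\
  forall w, tangent F p w -> dot1 (grad_t F p) w = w.2.
Proof.
move=> dF.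
have s2 := sqr_sqrtr (ltW nabla_gt0); rewrite -/(enorm1 _) in s2.
have s0 : enorm1 (nabla F p) != 0 by rewrite gt_eqF// sqrtr_gt0.
split=> [|w]; rewrite /tangent /= derive_nabla//.
  rewrite /grad_t /nu dot1C dot1D -scaleNr !dot1Z !et -s2 /=.
  rewrite (_ : _ *: dF_t F p = (enorm1 (nabla F p))^-1 * dF_t F p)//.
  by field.
by rewrite /grad_t /nu dot1D -scaleNr !dot1Z et => ->; rewrite !mulr0 addr0.
Qed.

Lemma enorm1_grad_t :
  enorm1 (grad_t F p) = enorm (dF_x F p) / enorm1 (nabla F p).
Proof.
have s2 := sqr_sqrtr (ltW nabla_gt0); rewrite -/(enorm1 _) in s2.
have s0 : 0 < enorm1 (nabla F p) by rewrite sqrtr_gt0.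
rewrite -[enorm1 _ in RHS](ger0_norm (ltW s0)) -sqrtr_sqr -sqrtrV ?sqr_ge0//.
rewrite -sqrtrM; last by apply: sumr_ge0 => i _; rewrite -expr2 sqr_ge0.
congr Num.sqrt.
have -> : dot (dF_x F p) (dF_x F p) = enorm1 (nabla F p) ^+ 2 - dF_t F p ^+ 2.
  by rewrite s2 /dot1 /= expr2 addrK.
rewrite /grad_t /nu dot1D -scaleNr et !dot1Z.
rewrite [dot1 (nabla _ _) (_ + _)]dot1C dot1D !dot1Z et -s2 /=.
rewrite (_ : _ *: dF_t F p = (enorm1 (nabla F p))^-1 * dF_t F p)//.
rewrite et /= (_ : forall a b : R, a *: (b : R) = a * b)//.
by field; rewrite gt_eqF.
Qed.

End gradient.

(* Spherical compactification of R^n: the topology is the one of the closed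
   unit ball, transported by x |-> x / sqrt (1 + |x|^2) on R^n and by the
   inclusion on the sphere at infinity; see [cvg_sphc_inr], [cvg_sphc_inl]. *)
Definition sphere (R : realType) (n : nat) : set 'rV[R]_n :=
  [set u | enorm u = 1].
Arguments sphere : clear implicits.

Definition to_ball (R : realType) (n : nat) (z : 'rV[R]_n + sphere R n) :
    'rV[R]_n :=
  match z with inl x => ball_map x | inr u => set_val u end.

Definition sphc (R : realType) (n : nat) := initial_topology (@to_ball R n).
HB.instance Definition _ (R : realType) (n : nat) := Topological.on (sphc R n).

Section compactification_topology.
Context {R : realType} {n : nat} {T : Type} {D : set_system T} {DF : Filter D}.
Implicit Types (x : T -> 'rV[R]_n).

Let dot_ge0 (v : 'rV[R]_n) : 0 <= dot v v.
Proof. by apply: sumr_ge0 => i _; rewrite -expr2 sqr_ge0. Qed.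

Let enorm_ge0 (v : 'rV[R]_n) : 0 <= enorm v.
Proof. exact: sqrtr_ge0. Qed.

Let enorm_eq0 (v : 'rV[R]_n) : enorm v = 0 -> v = 0.
Proof.
move/eqP; rewrite sqrtr_eq0 => v0; apply/rowP => i; rewrite mxE.
have /eqP : dot v v = 0 by apply/eqP; rewrite eq_le v0 dot_ge0.
rewrite psumr_eq0 => [/allP/(_ i)|j _]; last by rewrite -expr2 sqr_ge0.
by rewrite mem_index_enum mulf_eq0 orbb => /(_ isT)/eqP.
Qed.

Let enormZ a (v : 'rV[R]_n) : enorm (a *: v) = `|a| * enorm v.
Proof.
rewrite /enorm -sqrtr_sqr -sqrtrM ?sqr_ge0//; congr Num.sqrt.
by rewrite /dot mulr_sumr; apply: eq_bigr => i _; rewrite !mxE; ring.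
Qed.

Let enorm_continuous : continuous (@enorm R n).
Proof.
have H : continuous (fun v : 'rV[R]_n => dot v v).
  apply: continuous_big => [|i _ v]; first exact: add_continuous.
  by apply: continuousM; exact: coord_continuous.
by move=> v; apply: continuous_comp (H v) _; exact: sqrt_continuous.
Qed.

Let den (v : 'rV[R]_n) : R := Num.sqrt (1 + enorm v ^+ 2).

Let den_gt0 v : 0 < den v.
Proof. by rewrite sqrtr_gt0 ltr_pwDl ?sqr_ge0. Qed.

Let den_sqr v : den v ^+ 2 = 1 + enorm v ^+ 2.
Proof. by rewrite sqr_sqrtr// addr_ge0 ?sqr_ge0. Qed.

Let ball_mapN v : enorm (ball_map v) = enorm v / den v.
Proof. by rewrite enormZ ger0_norm ?invr_ge0 ?sqrtr_ge0// mulrC. Qed.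

Let ball_mapN2 (v : 'rV[R]_n) : 1 - enorm (ball_map v) ^+ 2 = (1 + enorm v ^+ 2)^-1.
Proof.
rewrite ball_mapN exprMn exprVn den_sqr.
have : 0 < 1 + enorm v ^+ 2 by rewrite -den_sqr exprn_gt0.
by move/lt0r_neq0 => h; field.
Qed.

Lemma cvg_sphc (z : T -> sphc R n) (z0 : sphc R n) :
  z @ D --> z0 <-> to_ball (z t) @[t --> D] --> to_ball z0.
Proof.
split=> [zz0 A /(@initial_continuous _ _ (@to_ball R n) z0) /zz0//|h A].
case=> [B [[C oC <-] Cz0 CA]].
have : nbhs (to_ball z0) C by exact: open_nbhs_nbhs.
by move/h; apply: (@filterS _ D) => t; exact: CA.
Qed.

Lemma cvg_sphc_inr x (u : sphere R n) :
  (inl (x t) : sphc R n) @[t --> D] --> (inr u : sphc R n) <->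
  enorm (x t) @[t --> D] --> +oo /\
  (enorm (x t))^-1 *: x t @[t --> D] --> set_val u.
Proof.
have u1 : enorm (set_val u) = 1 by exact: (set_valP u).
pose h t := enorm (ball_map (x t)).
rewrite cvg_sphc /=; split=> [yu|[roo xu]].
  have h1 : h t @[t --> D] --> (1 : R).
    by rewrite -u1; apply: continuous_cvg yu; exact: enorm_continuous.
  have h1q : h t ^+ 2 @[t --> D] --> (1 : R).
    by rewrite -[X in _ --> X](mulr1 1); apply: cvgM.
  have roo : enorm (x t) @[t --> D] --> +oo.
    apply/cvgryPge => A; near=> t.
    rewrite leNgt; apply/negP => rA.
    have A0 : 0 < A by exact: le_lt_trans rA.
    have : (1 + enorm (x t) ^+ 2)^-1 < (1 + A ^+ 2)^-1.
      rewrite -ball_mapN2 ltrBlDr -ltrBlDl.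
      near: t; apply: (cvgr_gt _ h1q).
      by rewrite ltrBlDr ltrDl invr_gt0 ltr_pwDl ?sqr_ge0.
    have pos (a : R) : 0 < 1 + a ^+ 2 by rewrite ltr_pwDl ?sqr_ge0.
    rewrite ltf_pV2 ?posrE// ltrD2l ltr_pXn2r ?nnegrE ?(ltW A0)//.
    by rewrite ltNge (ltW rA).
  split => //.
  have : (h t)^-1 *: ball_map (x t) @[t --> D] --> 1^-1 *: set_val u.
    apply: cvgZ => //.
    by apply: cvgV => //; exact: oner_neq0.
  rewrite invr1 scale1r; apply: cvg_trans; apply: near_eq_cvg; near=> t.
  rewrite /h ball_mapN /ball_map -/(den _) scalerA; congr (_ *: _).
  have r0 : 0 < enorm (x t) by near: t; exact: (cvgryPgt _).1 roo 0.
  by field; rewrite (lt0r_neq0 r0) (lt0r_neq0 (den_gt0 _)).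
have h2 : 1 - (1 + enorm (x t) ^+ 2)^-1 @[t --> D] --> (1 : R).
  rewrite -[X in _ --> X](subr0 1); apply: cvgB; first exact: cvg_cst.
  apply/cvgr0Pnorm_lt => e e0; near=> t.
  have r1 : 1 < enorm (x t) by near: t; exact: (cvgryPgt _).1 roo 1.
  have re : e^-1 < enorm (x t) by near: t; exact: (cvgryPgt _).1 roo _.
  have r0 : 0 < 1 + enorm (x t) ^+ 2 by rewrite ltr_pwDl ?sqr_ge0.
  rewrite ger0_norm ?invr_ge0 ?ltW// invf_plt ?posrE//.
  by apply: (lt_trans re); nra.
have h1 : h t @[t --> D] --> (1 : R).
  rewrite -[X in _ --> X]sqrtr1.
  rewrite (_ : h = fun t => Num.sqrt (1 - (1 + enorm (x t) ^+ 2)^-1)).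
    by apply: continuous_cvg h2; exact: sqrt_continuous.
  apply/funext => t; rewrite -ball_mapN2 opprB addrC subrK.
  by rewrite sqrtr_sqr ger0_norm.
rewrite -[X in _ --> X]scale1r.
rewrite (_ : (fun t => ball_map (x t)) =
             fun t => h t *: ((enorm (x t))^-1 *: x t)); first exact: cvgZ.
apply/funext => t; rewrite /h ball_mapN /ball_map -/(den _) scalerA.
have [/enorm_eq0 ->|r0] := eqVneq (enorm (x t)) 0; first by rewrite !scaler0.
congr (_ *: _); field; by rewrite r0 (lt0r_neq0 (den_gt0 _)).
Unshelve. all: by end_near. Qed.

Lemma cvg_sphc_inl x (a : 'rV[R]_n) :
  (inl (x t) : sphc R n) @[t --> D] --> (inl a : sphc R n) <->
  x t @[t --> D] --> a.
Proof.
pose g (y : 'rV[R]_n) : 'rV[R]_n :=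
  (Num.sqrt (1 - enorm y ^+ 2))^-1 *: y.
have gK v : g (ball_map v) = v.
  rewrite /g ball_mapN2 sqrtrV ?addr_ge0 ?sqr_ge0// invrK scalerA.
  by rewrite mulfV ?scale1r// (lt0r_neq0 (den_gt0 v)).
have gc y : enorm y < 1 -> {for y, continuous g}.
  move=> y1; rewrite /g; apply: continuousZ; last exact: cvg_id.
  apply: continuousV; first by rewrite sqrtr_eq0 -ltNge subr_gt0 expr_lt1.
  apply: (@continuous_comp _ _ _ (fun z => 1 - enorm z ^+ 2) Num.sqrt).
    apply: continuousB; first exact: cst_continuous.
    by apply: continuousM; exact: enorm_continuous.
  exact: sqrt_continuous.
have bc y : {for y, continuous (@ball_map R n)}.
  rewrite /ball_map; apply: continuousZ; last exact: cvg_id.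
  apply: continuousV; first exact: (lt0r_neq0 (den_gt0 y)).
  apply: (@continuous_comp _ _ _ (fun z => 1 + enorm z ^+ 2) Num.sqrt).
    apply: continuousD; first exact: cst_continuous.
    by apply: continuousM; exact: enorm_continuous.
  exact: sqrt_continuous.
rewrite cvg_sphc /=; split=> [ya|xa]; last by apply: continuous_cvg xa; exact: bc.
have a1 : enorm (ball_map a) < 1.
  rewrite -(expr_lt1 (n := 2))// -subr_gt0 ball_mapN2 invr_gt0.
  by rewrite ltr_pwDl ?sqr_ge0.
have h := continuous_cvg _ (gc _ a1) ya; rewrite gK in h.
have e : (fun t => g (ball_map (x t))) = x by apply/funext => t; exact: gK.
rewrite -e; exact: h.
Qed.

End compactification_topology.

(* G^(1,n+1): a nonzero linear form on R^n x R is given by its coefficients,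
   acting through [dot1]; lines of forms are classes modulo nonzero scalars,
   with the quotient topology. *)
Definition covec (R : realType) (n : nat) : set ('rV[R]_n * R) :=
  [set xi | xi != 0].
Arguments covec : clear implicits.

Definition proportional (R : realType) (n : nat) : rel (covec R n) :=
  fun xi eta => `[< exists2 a : R, a != 0 & set_val eta = a *: set_val xi >].

Lemma proportional_refl R n : reflexive (@proportional R n).
Proof. by move=> xi; apply/asboolP; exists 1; rewrite ?oner_eq0 ?scale1r. Qed.

Lemma proportional_sym R n : symmetric (@proportional R n).
Proof.
suff H xi eta : @proportional R n xi eta -> @proportional R n eta xi.
  by move=> xi eta; apply/idP/idP; exact: H.
move=> /asboolP[a a0 e]; apply/asboolP; exists a^-1; first by rewrite invr_eq0.
by rewrite e scalerA mulVf ?scale1r.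
Qed.

Lemma proportional_trans R n : transitive (@proportional R n).
Proof.
move=> eta xi zeta /asboolP[a a0 e] /asboolP[b b0 e']; apply/asboolP.
by exists (b * a); [rewrite mulf_neq0|rewrite e' e scalerA].
Qed.

Canonical proportional_equiv R n := EquivRel (@proportional R n)
  (@proportional_refl R n) (@proportional_sym R n) (@proportional_trans R n).

Definition covec_lines (R : realType) (n : nat) :=
  quotient_topology {eq_quot (@proportional_equiv R n)}.
HB.instance Definition _ (R : realType) (n : nat) :=
  Topological.copy (covec_lines R n)
    (quotient_topology {eq_quot (@proportional_equiv R n)}).
HB.instance Definition _ (R : realType) (n : nat) :=
  Quotient.copy (covec_lines R n)
    (quotient_topology {eq_quot (@proportional_equiv R n)}).

Definition line_ker (R : realType) (n : nat) (L : covec_lines R n) :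
    set ('rV[R]_n * R) :=
  [set w | dot1 (set_val (repr L)) w = 0].

Lemma line_ker_pi (R : realType) (n : nat) (xi : covec R n) :
  line_ker (\pi_(covec_lines R n) xi) = [set w | dot1 (set_val xi) w = 0].
Proof.
have /eqmodP/asboolP[a a0 e] :
    \pi_(covec_lines R n) (repr (\pi_(covec_lines R n) xi)) =
    \pi_(covec_lines R n) xi by rewrite reprK.
have dotZ q w : dot1 (a *: q) w = a * dot1 q w :> R.
  rewrite /dot1 /= mulrDr mulrA; congr (_ + _).
  by rewrite mulr_sumr; apply: eq_bigr => i _; rewrite mxE mulrA.
apply/seteqP; rewrite e; split=> w /=; rewrite dotZ.
  by rewrite /line_ker /= => ->; rewrite mulr0.
by move/eqP; rewrite mulf_eq0 (negPf a0) => /eqP.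
Qed.

Section at_infinity.
Context {R : realType} {n : nat}.
Variable F : 'rV[R]_n * R -> R.
Implicit Types (p w : 'rV[R]_n * R) (c : R) (u : sphere R n).

Definition at_fin p : sphc R n * R := (inl p.1, p.2).
Definition at_inf (z : sphere R n * R) : sphc R n * R := (inr z.1, z.2).

Definition Minf : set (sphere R n * R) :=
  [set z | closure (at_fin @` hsurf F) (at_inf z)].

(* Where [nu_x] vanishes the normalised vector is 0 by convention, which is
   orthogonal to u, so such points impose no condition. *)
Definition horizontally_spherical c :=
  forall (p : nat -> 'rV[R]_n * R) u,
    (forall k, hsurf F (p k)) -> Minf (u, c) ->
    at_fin (p k) @[k --> \oo] --> at_inf (u, c) ->
    forall v : 'rV[R]_n,
      cluster ((enorm (nu_x F (p k)))^-1 *: nu_x F (p k) @[k --> \oo]) v ->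
      dot v (set_val u) = 0.

Definition radius p : R := enorm p.1.

Definition radius_regular p :=
  [/\ hsurf F p, p.1 != 0 & exists2 w, tangent F p w & 'D_w radius p != 0].

Definition tangent_level p : set ('rV[R]_n * R) :=
  tangent F p `&` [set w | 'D_w radius p = 0].

Definition conormal : set (sphc R n * R * covec_lines R n) :=
  [set y | exists2 p, radius_regular p &
             y.1 = at_fin p /\ tangent_level p `<=` line_ker y.2].

Definition char_covectors (z : sphere R n * R) : set (covec_lines R n) :=
  [set L | Minf z /\ closure conormal (at_inf z, L)].

Definition tau_conormal : set (covec_lines R n) :=
  [set L | line_ker L = [set w | w.2 = 0]].

Definition t_equisingular_at (z : sphere R n * R) :=
  char_covectors z `&` tau_conormal = set0.

Definition t_equisingular c := forall u, Minf (u, c) -> t_equisingular_at (u, c).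

End at_infinity.

(* Main.v *)
(* Malgrange's condition at c gives |x| |dF_x| >= A |nabla F| on M far away and
   near level c.  If t is not horizontally spherical, there are points of M with
   |x| arbitrarily large at which the normal has a radial component
   |<dF_x, x>| >= delta |x| |dF_x|.  By o-minimality such points exist for all
   large radii s = |x|, and the lexicographically least one with |t - c| bounded
   is a definable curve p(s) = (s theta(s), t(s)).  Bounded definable functions f
   of s are continuous for large s (a function with one-sided limits everywhere
   has a dense set of continuity points, by Baire) and satisfy s f'(s) -> 0,
   otherwise f(2 s) - f(s) would stay away from 0.  Differentiating F(p(s)) = 0
   then gives <dF_x, theta> = o(|dF_x| + |dF_t| / s) = o(|dF_x|), which is absurd.
   If Malgrange's condition fails at c, a limit of the lines spanned by nabla F
   along offending points is the conormal dt of the levels of t, so the family is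
   not t-equisingular: the second assertion follows from the first. *)
Require Import Defs.
From mathcomp Require Import all_boot all_order all_algebra.
From mathcomp Require Import all_classical all_reals all_analysis.
From mathcomp Require Import ring lra zify.
Import Order.TTheory GRing.Theory Num.Theory.
Import numFieldNormedType.Exports.
Set Implicit Arguments.
Unset Strict Implicit.
Unset Printing Implicit Defensive.
Local Open Scope classical_set_scope.
Local Open Scope ring_scope.
Local Open Scope quotient_scope.

(** * Definable predicates and functions *)

Section definability.
Context {R : realType} (S : omin_structure R).
Local Notation env := (nat -> R).
Implicit Types (e : env) (P Q : env -> Prop) (f g : env -> R).

(** Padding by 0 lets one predicate on sequences be read in every dimension [q]. *)
Definition env_of q (x : 'rV[R]_q) : env :=
  fun k => if insub k is Some i then x 0 i else 0.

Lemma definable_ext q (A B : set 'rV[R]_q) : (forall x, A x <-> B x) ->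
  definable S A -> definable S B.
Proof.
move=> AB; suff -> : A = B by [].
by apply/funext => x; exact/propext.
Qed.

Lemma env_ofE q (x : 'rV[R]_q) (i : 'I_q) : env_of x i = x 0 i.
Proof. by rewrite /env_of valK. Qed.

Lemma env_of_lt q (x : 'rV[R]_q) k (kq : (k < q)%N) :
  env_of x k = x 0 (Ordinal kq).
Proof. by rewrite -env_ofE. Qed.

Lemma env_of_ge q (x : 'rV[R]_q) k : (q <= k)%N -> env_of x k = 0.
Proof. by move=> qk; rewrite /env_of insubN// -leqNgt. Qed.

Definition dset q P := definable S [set x : 'rV[R]_q | P (env_of x)].

(** [dset q P] only tests [P] on sequences that vanish from index [q] on; [supp] adds that those
    entries do not matter. *)
Definition supp q P := forall e e', (forall k, (k < q)%N -> e k = e' k) ->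
  P e -> P e'.

Lemma supp_le q q' P : (q <= q')%N -> supp q P -> supp q' P.
Proof. by move=> qq' sP e e' ee'; apply: sP => k /leq_trans/(_ qq'); exact: ee'. Qed.

Lemma supp_iff q P e e' : supp q P -> (forall k, (k < q)%N -> e k = e' k) ->
  P e <-> P e'.
Proof. by move=> sP ee'; split; apply: sP => k kq; rewrite ee'. Qed.

Lemma dset_ext q P Q : (forall e, P e <-> Q e) -> dset q P -> dset q Q.
Proof.
move=> PQ; apply: definable_ext => x; exact: PQ.
Qed.

Lemma dset_not q P : dset q P -> dset q (fun e => ~ P e).
Proof. exact: definableC. Qed.

Lemma dset_or q P Q : dset q P -> dset q Q -> dset q (fun e => P e \/ Q e).
Proof. exact: definableU. Qed.

Lemma dset_and q P Q : dset q P -> dset q Q -> dset q (fun e => P e /\ Q e).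
Proof.
move=> dP dQ; have := dset_not (dset_or (dset_not dP) (dset_not dQ)).
by apply: dset_ext => e; rewrite -not_andP notK.
Qed.

Lemma dset_false q : dset q (fun=> False).
Proof. exact: definable0. Qed.

Lemma dset_true q : dset q (fun=> True).
Proof. by apply: dset_ext (dset_not (dset_false q)) => e; split=> // _ []. Qed.

Lemma dset_eq q i j : (i < q)%N -> (j < q)%N -> dset q (fun e => e i = e j).
Proof.
move=> iq jq; apply: definable_ext (definable_diag S (Ordinal iq) (Ordinal jq)).
by move=> x; rewrite /= !env_of_lt.
Qed.

Lemma dset_widen q P : supp q P -> dset q P -> dset q.+1 P.
Proof.
move=> sP /definableXR; rewrite -[in dset _]addn1 /dset.
apply: definable_ext => x /=; apply: (supp_iff sP) => k kq.
rewrite !env_of_lt => [|h]; first by rewrite addn1 ltnS ltnW.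
by rewrite mxE; congr (x _ _); exact/val_inj.
Qed.

Lemma dset_le q q' P : (q <= q')%N -> supp q P -> dset q P -> dset q' P.
Proof.
move=> /subnKC <-; elim: (q' - q)%N => [|k IH] sP dP; first by rewrite addn0.
by rewrite addnS; apply: dset_widen (IH sP dP); exact: supp_le (leq_addr _ _) sP.
Qed.

Lemma dset_shift m q P : dset q P -> dset (m + q) (fun e => P (fun k => e (m + k)%N)).
Proof.
move=> dP; elim: m => [//|m /definableRX].
apply: definable_ext => x /=; rewrite [X in P X](_ : _ =
  (fun k => env_of x (m.+1 + k)%N))//; apply/funext => k.
have [kq|qk] := ltnP (m + k)%N (m + q)%N; last first.
  by rewrite !env_of_ge// addSn ltnS.
by rewrite !env_of_lt mxE; congr (x _ _); exact/val_inj.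
Qed.

Definition glue q e e' : env := fun k => if (k < q)%N then e k else e' (k - q)%N.

(** Projection removes the last coordinate, so the bound variable sits at index [q]. *)
Lemma dset_ex1 q P : supp q.+1 P -> dset q.+1 P ->
  dset q (fun e => exists r, P (glue q e (fun=> r))).
Proof.
move=> sP; rewrite -[in dset _]addn1 => /definable_proj; rewrite /dset.
apply: definable_ext => y; split=> [[x Px <-]|[r Pr]].
  exists (x 0 (rshift q ord0)); apply: sP Px => k; rewrite ltnS leq_eqVlt.
  rewrite /glue => /predU1P[->|kq].
    by rewrite ltnn -env_ofE; congr (env_of x); exact/esym/addn0.
  rewrite kq !env_of_lt => [|h]; first by rewrite addn1 ltnW.
  by rewrite mxE; congr (x _ _); exact/val_inj.
exists (row_mx y (const_mx r)); last by rewrite row_mxKl.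
apply: sP Pr => k; rewrite ltnS leq_eqVlt /glue => /predU1P[->|kq].
  rewrite ltnn [RHS](_ : _ =
      env_of (row_mx y (const_mx r : 'rV_1)) (rshift q (@ord0 0))).
    by rewrite env_ofE row_mxEr mxE.
  by congr (env_of (row_mx _ _)); exact/esym/addn0.
rewrite kq env_of_lt; have /= := env_ofE (row_mx y (const_mx r : 'rV_1)).
by move=> /(_ (lshift 1 (Ordinal kq))) ->; rewrite row_mxEl.
Qed.

Lemma dset_exn q m P : supp (q + m) P -> dset (q + m) P ->
  dset q (fun e => exists z, P (glue q e z)).
Proof.
elim: m P => [|m IH] P; rewrite ?addn0 ?addnS => sP dP.
  apply: dset_ext dP => e; split=> [Pe|[z]].
    by exists (fun=> 0); apply: sP Pe => k kq; rewrite /glue kq.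
  by apply: sP => k kq; rewrite /glue kq.
have sP1 : supp (q + m) (fun e => exists r, P (glue (q + m) e (fun=> r))).
  move=> e e' ee' [r Pr]; exists r; apply: sP Pr => k _; rewrite /glue.
  by case: ifPn => // kqm; exact: ee'.
apply: dset_ext (IH _ sP1 (dset_ex1 sP dP)) => e; split=> [[z [r Pr]]|[z Pz]].
  exists (glue m z (fun=> r)); apply: sP Pr => k kqm; rewrite /glue.
  case: ltnP => kqm'; case: ltnP => kq//; first by rewrite ifT//; lia.
    by lia.
  by rewrite ifF//; lia.
exists z, (z m); apply: sP Pz => k kqm; rewrite /glue.
case: ltnP => kq; case: ltnP => kqm'//; first by lia.
by congr z; lia.
Qed.

(* Predicates on environments [nat -> R] replace subsets of R^q, so that adding,
   permuting and quantifying variables involves no dimension casts; entries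
   are de Bruijn indices in [dfn_ex] and [dfn_all] below. *)
Definition dfn P := exists q, supp q P /\ dset q P.

Lemma dfn_ext P Q : (forall e, P e <-> Q e) -> dfn P -> dfn Q.
Proof.
move=> PQ; suff -> : P = Q by [].
by apply/funext => e; exact/propext.
Qed.

Lemma dfn_not P : dfn P -> dfn (fun e => ~ P e).
Proof.
move=> [q [sP dP]]; exists q; split; last exact: dset_not.
by move=> e e' ee' nP; apply: contra_not nP; apply: sP => k kq; rewrite ee'.
Qed.

Lemma dfn_and P Q : dfn P -> dfn Q -> dfn (fun e => P e /\ Q e).
Proof.
move=> [q [sP dP]] [q' [sQ dQ]]; exists (maxn q q').
have ? := leq_maxl q q'; have ? := leq_maxr q q'; split.
  by move=> e e' ee' [Pe Qe]; split; [move: Pe|move: Qe];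
    [apply: supp_le sP _ _ _|apply: supp_le sQ _ _ _]; try exact: ee'.
by apply: dset_and; [apply: dset_le sP dP|apply: dset_le sQ dQ].
Qed.

Lemma dfn_or P Q : dfn P -> dfn Q -> dfn (fun e => P e \/ Q e).
Proof.
move=> dP dQ; have := dfn_not (dfn_and (dfn_not dP) (dfn_not dQ)).
by apply: dfn_ext => e; rewrite -not_orP notK.
Qed.

Lemma dfn_imp P Q : dfn P -> dfn Q -> dfn (fun e => P e -> Q e).
Proof.
move=> dP dQ; have := dfn_or (dfn_not dP) dQ.
by apply: dfn_ext => e; rewrite implyE.
Qed.

Lemma dfn_true : dfn (fun=> True).
Proof. by exists 0%N; split => //; exact: dset_true. Qed.

Lemma dfn_all_lt n (P : nat -> env -> Prop) : (forall i, (i < n)%N -> dfn (P i)) ->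
  dfn (fun e => forall i, (i < n)%N -> P i e).
Proof.
elim: n => [_|n IH dP]; first by apply: dfn_ext dfn_true.
have := dfn_and (IH (fun i ii => dP i (ltnW ii))) (dP n (ltnSn n)).
apply: dfn_ext => e; split=> [[Pn P0] i|Pn].
  by rewrite ltnS leq_eqVlt => /predU1P[->//|]; exact: Pn.
by split=> [i ii|]; apply: Pn => //; exact: ltnW.
Qed.

Lemma dfn_var_eq i j : dfn (fun e => e i = e j).
Proof.
exists (maxn i j).+1; split; last by apply: dset_eq; rewrite ltnS ?leq_maxl ?leq_maxr.
by move=> e e' ee'; rewrite !ee' ?ltnS ?leq_maxl ?leq_maxr.
Qed.

(* Variables [sigma k] may collide: [P] is put on fresh variables [m + k], which
   are tied to [sigma k] and projected away. *)
Lemma dset_rename q m P (sigma : nat -> nat) :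
  (forall k, (k < q)%N -> (sigma k < m)%N) -> supp q P -> dset q P ->
  dset m (fun e => P (fun k => e (sigma k))).
Proof.
move=> mP sP dP; pose Q0 e := forall i, (i < q)%N -> e (sigma i) = e (m + i)%N.
pose Q e := Q0 e /\ P (fun k => e (m + k)%N).
have sQ : supp (m + q) Q.
  move=> e e' ee' [Q0e Pe]; split=> [i iq|].
    by rewrite -!ee' ?ltn_add2l ?Q0e// (leq_trans (mP _ iq))// leq_addr.
  by apply: sP Pe => k kq; rewrite ee' ?ltn_add2l.
have dQ : dset (m + q) Q.
  apply: dset_and; last exact: dset_shift.
  suff : forall q', (q' <= q)%N -> dset (m + q) (fun e => forall i, (i < q')%N ->
      e (sigma i) = e (m + i)%N) by apply.
  elim=> [_|k IH kq]; first by apply: dset_ext (dset_true _).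
  have := dset_and (IH (ltnW kq)) (@dset_eq (m + q) (sigma k) (m + k) _ _).
  rewrite ltn_add2l kq (leq_trans (mP _ kq)) ?leq_addr// => /(_ isT isT).
  apply: dset_ext => e; split=> [[Pn P0] i|Pn].
    by rewrite ltnS leq_eqVlt => /predU1P[->//|]; exact: Pn.
  by split=> [i ii|]; apply: Pn => //; exact: ltnW.
apply: dset_ext (dset_exn sQ dQ) => e; split=> [[z [zs]]|Pe].
  apply: sP => k kq; have := zs _ kq; by rewrite /glue mP.
exists (fun k => e (sigma k)); split.
  move=> i iq; rewrite /glue mP// ifN ?addKn// -leqNgt; exact: leq_addr.
by apply: sP Pe => k kq; rewrite /glue ifN ?addKn// -leqNgt leq_addr.
Qed.

Lemma dfn_rename P (sigma : nat -> nat) : dfn P ->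
  dfn (fun e => P (fun k => e (sigma k))).
Proof.
move=> [q [sP dP]]; pose m := (\max_(i < q) sigma i).+1.
have mP k : (k < q)%N -> (sigma k < m)%N.
  by move=> kq; rewrite ltnS (leq_bigmax (Ordinal kq)).
exists m; split; last exact: dset_rename mP sP dP.
by move=> e e' ee'; apply: sP => k /mP; exact: ee'.
Qed.

Definition scons (r : R) e : env := fun k => if k is k'.+1 then e k' else r.

Lemma dfn_ex_scons P : dfn P -> dfn (fun e => exists r, P (scons r e)).
Proof.
move=> [q [sP0 dP0]].
have sP : supp q.+1 P by exact: supp_le sP0.
have dP : dset q.+1 P by exact: dset_le dP0.
(* The quantifier binds index 0, the projection the last index: [sigma] takes the bound variable
   from one place to the other. *)
pose sigma k := if k is k'.+1 then k' else q.
have sl k : (k < q.+1)%N -> (sigma k < q.+1)%N by case: k => //= k /ltnW.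
have dQ := dset_rename sl sP dP.
exists q; split.
  move=> e e' ee' [r Pr]; exists r; apply: sP Pr => -[//|k]; exact: ee'.
apply: dset_ext (dset_ex1 _ dQ) => [e|].
  split=> -[r Pr]; exists r; apply: sP Pr => -[|k] kq //=;
    by rewrite /glue /= ?ltnn// ifT.
by move=> e e' ee'; apply: sP => k /sl; exact: ee'.
Qed.

Lemma dfn_ex (P : env -> R -> Prop) : dfn (fun e => P (fun k => e k.+1) (e 0%N)) ->
  dfn (fun e => exists r, P e r).
Proof. exact: dfn_ex_scons. Qed.

Lemma dfn_all (P : env -> R -> Prop) : dfn (fun e => P (fun k => e k.+1) (e 0%N)) ->
  dfn (fun e => forall r, P e r).
Proof.
move=> /dfn_not/(@dfn_ex (fun e r => ~ P e r))/dfn_not.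
apply: dfn_ext => e; rewrite -forallNP; split=> h r; last exact.
by apply: contrapT; exact: h.
Qed.

(** Quantification over a block stored in the first [n] entries; truncating [z] makes only those
    entries count. In the induction the last entry of the block is bound outermost. *)
Lemma dfn_exn n (P : env -> env -> Prop) :
  dfn (fun e => P (fun k => e (n + k)%N) (glue n e (fun=> 0))) ->
  dfn (fun e => exists z, P e (glue n z (fun=> 0))).
Proof.
elim: n P => [|n IH] P dP.
  apply: dfn_ext dP => e; rewrite (_ : (fun k => _) = e)//.
  by split=> [?|[z]]; [exists (fun=> 0)|].
have glueS e : glue n.+1 e (fun=> 0) =
    fun k => if k == n then e n else glue n e (fun=> 0) k.
  apply/funext => k; rewrite /glue ltnS leq_eqVlt.
  by case: eqP => [->|].
pose P1 e z := P (fun k => e k.+1) (fun k => if k == n then e 0%N else z k).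
have dP1 : dfn (fun e => exists z, P1 (scons (e 0%N) (fun k => e k.+1)) (glue n z (fun=> 0))).
  have := IH (fun e => P1 (scons (e 0%N) (fun k => e k.+1))); apply.
  apply: dfn_ext dP => e; rewrite glueS /P1 /= addn0.
  by under eq_fun do rewrite addSnnS.
apply: dfn_ext (@dfn_ex (fun e r => exists z, P1 (scons r e) (glue n z (fun=> 0))) dP1).
move=> e; split=> [[r [z]]|[z]].
  rewrite /P1 /= => Pz; exists (fun k => if k == n then r else z k).
  rewrite glueS eqxx; congr (P _ _): Pz; apply/funext => k.
  by case: eqP => // kn; rewrite /glue; case: ifP => // kn'; case: eqP.
by rewrite glueS => Pz; exists (z n), z.
Qed.

Lemma dfn_exv q (P : env -> 'rV[R]_q -> Prop) :
  dfn (fun e => P (fun k => e (q + k)%N) (\row_(i < q) e i)) ->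
  dfn (fun e => exists y, P e y).
Proof.
move=> dP; have := @dfn_exn q (fun e z => P e (\row_(i < q) z i)).
have rowE z : \row_(i < q) (glue q z (fun=> 0)) i = \row_(i < q) z i.
  by apply/rowP => i; rewrite !mxE /glue ltn_ord.
under eq_fun do rewrite rowE.
move=> /(_ dP); apply: dfn_ext => e; split=> [[z]|[y Py]]; first by eexists; eassumption.
exists (env_of y); rewrite rowE; congr (P _ _): Py.
by apply/rowP => i; rewrite mxE env_ofE.
Qed.

(** * Definable functions and terms *)

Definition dfnf f := dfn (fun e => e 0%N = f (fun k => e k.+1)).

(** [P] reads finitely many entries, so substitution amounts to an existential quantifier over a
    block [z] tied to the values [fs i e] for [i < q]. *)
Lemma dfn_comp P (fs : nat -> env -> R) : dfn P -> (forall k, dfnf (fs k)) ->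
  dfn (fun e => P (fun k => fs k e)).
Proof.
move=> [q [sP dP]] dfs.
have dP' : dfn P by exists q.
pose Q e z := (forall i, (i < q)%N -> z i = fs i e) /\ P z.
have : dfn (fun e => exists z, Q e (glue q z (fun=> 0))).
  apply: (@dfn_exn q Q); apply: dfn_and; last first.
    apply: dfn_ext dP' => e; apply: (supp_iff sP) => k kq.
    by rewrite /glue kq.
  apply: dfn_all_lt => i iq; rewrite /glue iq.
  pose sigma k := if k is k'.+1 then (q + k')%N else i.
  exact: dfn_rename sigma (dfs i).
apply: dfn_ext => e; split=> [[z [zf]]|Pf].
  by apply: sP => k kq; exact: zf.
exists (fun k => fs k e); split=> [i iq|]; first by rewrite /glue iq.
by apply: sP Pf => k kq; rewrite /glue kq.
Qed.

Lemma dfnf_var i : dfnf (fun e => e i).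
Proof. exact: dfn_var_eq. Qed.

Lemma dfnf_comp f (fs : nat -> env -> R) : dfnf f -> (forall k, dfnf (fs k)) ->
  dfnf (fun e => f (fun k => fs k e)).
Proof.
move=> df dfs.
pose gs k := if k is k'.+1 then fun e => fs k' (fun k => e k.+1) else fun e => e 0%N.
apply: (@dfn_comp _ gs df) => -[|k]; first exact: dfnf_var.
pose sigma k := if k is k'.+1 then k'.+2 else 0%N.
exact: dfn_rename sigma (dfs k).
Qed.

Lemma dfn_definable q (A : set 'rV[R]_q) : definable S A ->
  dfn (fun e => A (\row_(i < q) e i)).
Proof.
move=> dA; exists q; split.
  move=> e e' ee'; congr A; apply/rowP => i; rewrite !mxE; exact: ee'.
apply: definable_ext dA => x; rewrite /= (_ : \row__ _ = x)//.
by apply/rowP => i; rewrite mxE env_ofE.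
Qed.

(** Returns to a prescribed dimension: variables beyond the support of [P] are projected away. *)
Lemma definable_dfn q P : supp q P -> dfn P -> dset q P.
Proof.
move=> sP [m [sm dm]]; case: (leqP m q) => mq; first exact: dset_le dm.
have : dset (q + (m - q)) P by rewrite subnKC// ltnW.
rewrite -{1}(subnKC (ltnW mq)) in sm.
move=> /(dset_exn sm); apply: dset_ext => e; split=> [[z]|Pe].
  by apply: sP => k kq; rewrite /glue kq.
by exists (fun=> 0); apply: sP Pe => k kq; rewrite /glue kq.
Qed.

(** A point of the line is a degenerate interval, so [definable1] makes all real parameters
    available. *)
Lemma dfnf_cst (a : R) : dfnf (fun=> a).
Proof.
have : definable S [set x : 'rV[R]_1 | x 0 0 = a].
  apply/definable1; exists [:: `[a, a]]; apply/seteqP; split=> x /= => [->|].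
    by exists `[a, a]; rewrite ?mem_seq1// in_itv/= lexx.
  by case=> I; rewrite mem_seq1 => /eqP ->; rewrite in_itv/= => /andP[? ?]; apply/le_anti/andP.
by move=> /dfn_definable; apply: dfn_ext => e; rewrite /= mxE.
Qed.

Lemma dfn_args P (s : seq (env -> R)) : dfn P ->
  (forall k, (k < size s)%N -> dfnf (nth (fun=> 0) s k)) ->
  dfn (fun e => P (fun k => nth (fun=> 0) s k e)).
Proof.
move=> dP ds; apply: dfn_comp => // k; have [/ds//|sk] := ltnP k (size s).
by rewrite nth_default//; exact: dfnf_cst.
Qed.

Lemma dfnf_args f (s : seq (env -> R)) : dfnf f ->
  (forall k, (k < size s)%N -> dfnf (nth (fun=> 0) s k)) ->
  dfnf (fun e => f (fun k => nth (fun=> 0) s k e)).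
Proof.
move=> dP ds; apply: (@dfnf_comp f (nth (fun=> 0) s)) => // k.
have [/ds//|sk] := ltnP k (size s).
by rewrite nth_default//; exact: dfnf_cst.
Qed.

Lemma dfn_eq f g : dfnf f -> dfnf g -> dfn (fun e => f e = g e).
Proof.
move=> df dg; have := @dfn_args _ [:: f; g] (dfn_var_eq 0 1); apply.
by case=> [|[]].
Qed.

Lemma dfnf_add f g : dfnf f -> dfnf g -> dfnf (fun e => f e + g e).
Proof.
move=> df dg; have := @dfnf_args (fun e => e 0%N + e 1%N) [:: f; g].
apply; last by case=> [|[]].
(* The structure stores the sum in the last coordinate, [dfnf] stores the value at index 0. *)
have := dfn_rename (fun k => nth 0%N [:: 1; 2; 0]%N k) (dfn_definable (definable_add S)).
by apply: dfn_ext => e; rewrite /= !mxE.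
Qed.

Lemma dfnf_mul f g : dfnf f -> dfnf g -> dfnf (fun e => f e * g e).
Proof.
move=> df dg; have := @dfnf_args (fun e => e 0%N * e 1%N) [:: f; g].
apply; last by case=> [|[]].
have := dfn_rename (fun k => nth 0%N [:: 1; 2; 0]%N k) (dfn_definable (definable_mul S)).
by apply: dfn_ext => e; rewrite /= !mxE.
Qed.

Lemma dfnf_ext f g : f =1 g -> dfnf f -> dfnf g.
Proof. by move=> /funext ->. Qed.

Lemma dfnf_opp f : dfnf f -> dfnf (fun e => - f e).
Proof.
move=> df; have := dfnf_mul (dfnf_cst (-1)) df.
by apply: dfnf_ext => e; rewrite mulN1r.
Qed.

Lemma dfnf_sub f g : dfnf f -> dfnf g -> dfnf (fun e => f e - g e).
Proof. by move=> df dg; exact: dfnf_add df (dfnf_opp dg). Qed.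

Lemma dfnf_sum q (f : 'I_q -> env -> R) : (forall i, dfnf (f i)) ->
  dfnf (fun e => \sum_(i < q) f i e).
Proof.
elim: q f => [|q IH] f df.
  by apply: dfnf_ext (dfnf_cst 0) => e; rewrite big_ord0.
have := dfnf_add (IH (fun i => f (widen_ord (leqnSn q) i)) (fun i => df _)) (df ord_max).
by apply: dfnf_ext => e; rewrite big_ord_recr.
Qed.

Lemma dfnf_shift f : dfnf f -> dfnf (fun e => f (fun k => e k.+1)).
Proof. by move=> df; apply: (@dfnf_comp f (fun k e => e k.+1)) => // k; exact: dfnf_var. Qed.

(** The order comes from the ring structure: the nonnegative reals are the squares. *)
Lemma dfn_ge0 f : dfnf f -> dfn (fun e => 0 <= f e).
Proof.
move=> df; have df2 : dfn (fun e => f (fun k => e k.+1) = e 0%N * e 0%N).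
  by apply: dfn_eq; [exact: dfnf_shift|apply: dfnf_mul; exact: dfnf_var].
apply: dfn_ext (@dfn_ex (fun e r => f e = r * r) df2) => e; split=> [[r ->]|f0].
  by rewrite -expr2 sqr_ge0.
by exists (Num.sqrt (f e)); rewrite -expr2 sqr_sqrtr.
Qed.

Lemma dfn_le f g : dfnf f -> dfnf g -> dfn (fun e => f e <= g e).
Proof.
move=> df dg; apply: dfn_ext (dfn_ge0 (dfnf_sub dg df)) => e.
by rewrite subr_ge0.
Qed.

Lemma dfn_lt f g : dfnf f -> dfnf g -> dfn (fun e => f e < g e).
Proof.
move=> df dg; apply: dfn_ext (dfn_not (dfn_le dg df)) => e.
by rewrite ltNge; split=> /negP.
Qed.

Definition dfnv q (p : env -> 'rV[R]_q) := forall i, dfnf (fun e => p e 0 i).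

Lemma dfn_setv q (A : set 'rV[R]_q) (p : env -> 'rV[R]_q) :
  dfn (fun e => A (\row_(i < q) e i)) -> dfnv p -> dfn (fun e => A (p e)).
Proof.
move=> dA dp; have dk : forall k, dfnf (fun e => env_of (p e) k).
  move=> k; have [kq|qk] := ltnP k q.
    by apply: dfnf_ext (dp (Ordinal kq)) => e; rewrite env_of_lt.
  by apply: dfnf_ext (dfnf_cst 0) => e; rewrite env_of_ge.
apply: dfn_ext (@dfn_comp _ (fun k e => env_of (p e) k) dA dk) => e; rewrite (_ : \row__ _ = p e)//.
by apply/rowP => i; rewrite mxE env_ofE.
Qed.

End definability.

(** * Germs of definable functions of one variable *)

Lemma dfnf_fun1 (R : realType) (S : omin_structure R) (f : R -> R) (g : (nat -> R) -> R) :
  dfnf S (fun e => f (e 0%N)) -> dfnf S g -> dfnf S (fun e => f (g e)).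
Proof. by move=> df dg; apply: (@dfnf_comp _ _ (fun e => f (e 0%N)) (fun k e => g e)). Qed.

Lemma dfn_norm_lt (R : realType) (S : omin_structure R) (f g : (nat -> R) -> R) :
  dfnf S f -> dfnf S g -> dfn S (fun e => `|f e| < g e).
Proof.
move=> df dg; apply: dfn_ext (dfn_and (dfn_lt (dfnf_opp dg) df) (dfn_lt df dg)) => e.
by rewrite ltr_norml; split=> /andP.
Qed.

(** Recursion on the syntax of formulas and terms; applications of other definable functions are
    left as goals. *)
Ltac dfn_tac :=
  repeat match goal with
  | |- dfnf _ (fun e => e _) => exact: dfnf_var
  | |- dfnf _ (fun _ => ?a) => exact: (dfnf_cst _ a)
  | |- dfnf _ (fun e => _ + _) => apply: dfnf_add
  | |- dfnf _ (fun e => - _) => apply: dfnf_opp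
  | |- dfnf _ (fun e => _ * _) => apply: dfnf_mul
  | |- dfnf _ (fun e => \sum_(_ < _) _) => apply: dfnf_sum => ?
  | |- dfn _ (fun e => is_true (`|_| < _)) => apply: dfn_norm_lt
  | |- dfn _ (fun e => is_true (_ < _)) => apply: dfn_lt
  | |- dfn _ (fun e => is_true (_ <= _)) => apply: dfn_le
  | |- dfn _ (fun e => _ /\ _) => apply: dfn_and
  | |- dfn _ (fun e => _ \/ _) => apply: dfn_or
  | |- dfn _ (fun e => ~ _) => apply: dfn_not
  | |- dfn _ (fun e => exists r : _, _) => apply: dfn_ex; cbv beta
  | |- dfn _ (fun e => forall r : Real.sort _, _) => apply: dfn_all; cbv beta
  | |- dfn _ (fun e => _ -> _) => apply: dfn_imp
  | |- dfn _ (fun e => _ = _) => apply: dfn_eq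
  end.

Section o_minimality.
Context {R : realType} (S : omin_structure R).
Implicit Types (P : R -> Prop) (f : R -> R).

(** * Filters that decide every definable property *)

Section germs.
Context (D : set_system R) {FD : Filter D}.
Hypothesis D_lt : forall r, D [set x | x < r] \/ D [set x | r <= x].
Hypothesis D_le : forall r, D [set x | x <= r] \/ D [set x | r < x].

(** The hypotheses decide half-lines; decided sets are stable under complement and intersection, and
    an interval is cut out by its two bounds. *)
Lemma itv_germ (I : interval R) : D [set` I] \/ D (~` [set` I]).
Proof.
have DI A B : D A \/ D (~` A) -> D B \/ D (~` B) -> D (A `&` B) \/ D (~` (A `&` B)).
  move=> [dA|dA]; last by right; apply: filterS dA => x nA [].
  case=> [dB|dB]; last by right; apply: filterS dB => x nB [].
  by left; exact: filterI.
have Dlt r : D [set x | x < r] \/ D (~` [set x | x < r]).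
  have [|h] := D_lt r; [by left|right].
  by apply: filterS h => x /= h; apply/negP; rewrite -leNgt.
have Dle r : D [set x | x <= r] \/ D (~` [set x | x <= r]).
  have [|h] := D_le r; [by left|right].
  by apply: filterS h => x /= h; apply/negP; rewrite -ltNge.
have DC A : D A \/ D (~` A) -> D (~` A) \/ D (~` ~` A).
  by rewrite setCK => -[]; [right|left].
case: I => l u; rewrite (_ : [set` _] =
  [set x | (l <= BLeft x)%O] `&` [set x | (BRight x <= u)%O]); last first.
  by apply/seteqP; split=> x /=; rewrite itv_boundlr => /andP.
apply: DI.
  case: l => [[] r|b]; last by case: b; [left|right]; apply: filterE => x /=.
    by have := DC _ (Dlt r); congr (D _ \/ D (~` _));
      apply/seteqP; split=> x /=; rewrite bnd_simp leNgt => /negP.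
  by have := DC _ (Dle r); congr (D _ \/ D (~` _));
    apply/seteqP; split=> x /=; rewrite bnd_simp ltNge => /negP.
by case: u => [[] r|b]; [exact: Dlt|exact: Dle|case: b; [right|left]; apply: filterE => x /=].
Qed.

(** By [definable1] the set is a finite union of intervals. If the filter contains one of them it
    contains the union; otherwise it contains all the complements, hence their finite
    intersection. *)
Lemma dfn_germ P : dfn S (fun e => P (e 0%N)) ->
  (\forall x \near D, P x) \/ (\forall x \near D, ~ P x).
Proof.
have sP : supp 1 (fun e : nat -> R => P (e 0%N)) by move=> e e' ee'; rewrite ee'.
move=> /(definable_dfn sP) /definable1 [s sE].
have PE x : P x <-> exists2 I : interval R, I \in s & x \in I.
  have : [set y : 'rV[R]_1 | P (env_of y 0%N)] (const_mx x) <-> P x.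
    by rewrite /= (env_of_lt _ (ltn0Sn 0)) mxE.
  by rewrite sE /= mxE => <-.
elim: s {sE} P PE {sP} => [|I s IH] P PE.
  by right; apply: filterE => x /PE[].
have [h|h] := itv_germ I.
  by left; apply: filterS h => x xI; apply/PE; exists I; rewrite ?mem_head.
have [h'|h'] := IH (fun x => exists2 I : interval R, I \in s & x \in I) (fun x => iff_refl _).
  left; apply: filterS h' => x [J Js xJ]; apply/PE; exists J => //.
  by rewrite inE Js orbT.
right; apply: filterS2 h h' => x xI xs /PE[J]; rewrite inE => /predU1P[->//|Js xJ].
by apply: xs; exists J.
Qed.

End germs.

Lemma dfn_germ_pinfty P : dfn S (fun e => P (e 0%N)) ->
  (\forall x \near +oo, P x) \/ (\forall x \near +oo, ~ P x).
Proof.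
move=> dP; apply: (dfn_germ (D := +oo)) dP => r; right.
  by have := nbhs_pinfty_ge (num_real r).
by have := nbhs_pinfty_gt (num_real r).
Qed.

Lemma dfn_germ_right P a : dfn S (fun e => P (e 0%N)) ->
  (\forall x \near a^'+, P x) \/ (\forall x \near a^'+, ~ P x).
Proof.
move=> dP; apply: (dfn_germ (D := a^'+)) dP => r; have [ra|ar] := leP r a.
- by right; near=> x; rewrite /= (le_trans ra)// ltW.
- by left; near=> x; rewrite /=; near: x; exact: nbhs_right_lt.
- by right; near=> x; rewrite /= (le_lt_trans ra).
- by left; near=> x; rewrite /=; near: x; exact: nbhs_right_le.
Unshelve. all: by end_near. Qed.

(** The limit is the supremum of the [r] that stay below [f] near [a]: if [f] were not eventually
    below [sup A + e], the dichotomy would put [sup A + e] into [A]. *)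
Lemma dfn_cvg_right f (B a : R) : dfnf S (fun e => f (e 0%N)) ->
  (forall x, `|f x| <= B) -> cvg (f x @[x --> a^'+]).
Proof.
move=> df fB; pose A := [set r | \forall x \near a^'+, r <= f x].
have hsA : has_sup A.
  split; first by exists (- B); near=> x; have := fB x; rewrite ler_norml => /andP[].
  exists B => r /= Ar; near a^'+ => x; apply: (@le_trans _ _ (f x)).
    by near: x.
  by have := fB x; rewrite ler_norml => /andP[].
apply/cvg_ex; exists (sup A); apply/cvgrPdist_lt => e e0.
have [r Ar rA] := sup_adherent e0 hsA.
have h : \forall x \near a^'+, ~ (sup A + e <= f x).
  have [h|//] := @dfn_germ_right (fun x => sup A + e <= f x) a
    (dfn_le (dfnf_cst _ _) df).
  have := ub_le_sup hsA.2 h; rewrite gerDl; by rewrite leNgt e0.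
near=> x; have rf : r <= f x by near: x.
have fs : f x < sup A + e by rewrite ltNge; apply/negP; near: x.
by rewrite ltr_norml; apply/andP; split; lra.
Unshelve. all: by end_near. Qed.

(** Continuity at [s] is definable in [s], so it holds for all large [s] or fails for all large [s];
    Baire's theorem produces a continuity point beyond any bound, which excludes failure. *)
Lemma dfn_near_continuous f (B : R) : dfnf S (fun e => f (e 0%N)) ->
  (forall x, `|f x| <= B) -> \forall s \near +oo, {for s, continuous f}.
Proof.
move=> df fB.
pose P s := forall e : R, 0 < e -> exists d : R, 0 < d /\
  forall x : R, `|x - s| < d -> `|f x - f s| < e.
have PE s : P s <-> {for s, continuous f}.
  rewrite /prop_for /continuous_at; split=> [Ps|/cvgrPdist_lt cs e /cs].
    apply/cvgrPdist_lt => e /Ps[d [d0 ds]].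
    near=> x; rewrite distrC; apply: ds; near: x.
    by exists d => //= x; rewrite /ball/= distrC.
  by move=> [d /= d0 ds]; exists d; split=> // x xs; rewrite distrC; apply: ds;
    rewrite /ball /= distrC.
have dP : dfn S (fun e => P (e 0%N)).
  by rewrite /P; dfn_tac; exact: (dfnf_fun1 df (dfnf_var S _)).
have [h|] := dfn_germ_pinfty dP; first by apply: filterS h => s /PE.
move=> [M [_ MP]]; exfalso.
(* The points near which [f] oscillates by less than [1 / (n + 1)]; a point in all of the [F n] is a
   continuity point. *)
pose F (n : nat) := [set s | exists a b, a < s < b /\
  forall x y, a < x < b -> a < y < b -> `|f x - f y| < n.+1%:R^-1].
have Fo n : open (F n).
  rewrite openE => s [a [b [/andP[sa sb] ab]]].
  near=> z; exists a, b; split=> //; apply/andP; split; near: z.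
    exact: lt_nbhsr.
  exact: lt_nbhsl.
have Fd n : dense (F n).
  (* Just to the right of [s] the function is close to its right limit, so it oscillates little on
     [(s, s + c)], whose midpoint lies in [O]. *)
  move=> O [/= s Os] oO; have /cvg_ex[/= l fl] := @dfn_cvg_right f B s df fB.
  have n0 : 0 < (n.+1%:R^-1 : R) / 2 by rewrite divr_gt0.
  have : \forall x \near s^'+, `|l - f x| < n.+1%:R^-1 / 2.
    by move/cvgrPdist_lt : fl; exact.
  move=> [d /= d0 ds].
  have [d' /= d'0 d's] : nbhs s O by exact: open_nbhs_nbhs.
  pose c := Num.min d d'.
  have c0 : 0 < c by rewrite lt_min d0.
  have [cd cd'] : c <= d /\ c <= d' by split; rewrite ge_min lexx ?orbT.
  exists (s + c / 2); split.
    apply: d's; rewrite /ball /= opprD addNKr normrN ger0_norm; lra.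
  exists s, (s + c); split; first by apply/andP; split; lra.
  have dd z : s < z < s + c -> `|l - f z| < n.+1%:R^-1 / 2.
    move=> /andP[sz zc]; apply: ds => //.
    by rewrite /ball /= ltr_norml; apply/andP; split; lra.
  move=> x y /dd lx /dd ly; rewrite (le_lt_trans (ler_distD l _ _))//.
  by rewrite (splitr n.+1%:R^-1) distrC ltrD.
have /Baire/(_ [set x | M < x]) : forall i, open (F i) /\ dense (F i) by [].
case; [by exists (M + 1); rewrite /= ltrDl|exact: open_gt|].
move=> s [/= Ms Fs]; apply: (MP s Ms) => e e0.
have [n ne] : exists n : nat, n.+1%:R^-1 < e.
  have := @near_infty_natSinv_lt R (PosNum e0).
  by move=> [n _ /(_ n (leqnn n)) /= ne]; exists n.
have [a [b [/andP[sa sb] ab]]] := Fs n I.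
exists (Num.min (s - a) (b - s)); split.
  by rewrite lt_min !subr_gt0 sa.
move=> x; rewrite lt_min !ltr_norml => /andP[/andP[h1 h2] /andP[h3 h4]].
by rewrite -ltr_norml; apply: (lt_trans _ ne); apply: ab; apply/andP; split; lra.
Unshelve. all: by end_near. Qed.

(** Let [z] be the supremum of the points up to which [g] stays above [g p]. Continuity carries the
    inequality to [z], and the condition on the right of [z] carries it further unless [z = q]. *)
Lemma right_nondecreasing_le (g : R -> R) (p q : R) : p <= q ->
  (forall x, p <= x <= q -> {for x, continuous g}) ->
  (forall x, p <= x < q -> \forall y \near x^'+, g x <= g y) -> g p <= g q.
Proof.
move=> pq cg ig.
pose A := [set x | p <= x <= q /\ forall y, p <= y <= x -> g p <= g y].
have Ap : A p.
  split=> [|y /le_anti ->//]; by rewrite lexx.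
have hsA : has_sup A by split; [exists p|exists q => x [/andP[]]].
pose z := sup A.
have pz : p <= z := ub_le_sup hsA.2 Ap.
have zq : z <= q by apply: ge_sup; [exists p|move=> x [/andP[]]].
have ltz y : p <= y < z -> g p <= g y.
  move=> /andP[py yz]; rewrite -subr_gt0 in yz; have [x [_ Ax]] := sup_adherent yz hsA.
  rewrite -/z opprB addrC subrK => yx.
  by apply: Ax; rewrite py ltW.
have gz : g p <= g z.
  move: pz; rewrite le_eqVlt => /predU1P[<-//|pz]; rewrite leNgt; apply/negP => gzp.
  have h : \forall y \near z^'-, g y < g p.
    have := cg z; rewrite (ltW pz) zq => /(_ isT) /cvgr_lt/(_ _ gzp).
    by apply: cvg_at_left_filter; exact: cvg_id.
  near z^'- => y; have : g p <= g y.
    apply: ltz; apply/andP; split; near: y; last exact: nbhs_left_lt.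
    exact: nbhs_left_ge.
  by rewrite leNgt => /negP; apply; near: y.
move: zq; rewrite le_eqVlt => /predU1P[<-//|zq].
have [] := ig z; first by rewrite pz.
move=> d /= d0 ds; pose e := Num.min (d / 2) (q - z).
have e0 : 0 < e by rewrite lt_min divr_gt0//= subr_gt0.
have [ed eq] : e <= d / 2 /\ e <= q - z by split; rewrite ge_min lexx ?orbT.
have /(ub_le_sup hsA.2) : A (z + e).
  split; first by apply/andP; split; lra.
  move=> y /andP[py ye]; have [yz|zy|->//] := ltgtP y z.
    by apply: ltz; rewrite py.
  apply: (le_trans gz); apply: ds => //.
  by rewrite /ball /= ltr_norml; apply/andP; split; lra.
by rewrite -/z; lra.
Unshelve. all: by end_near. Qed.

(** A right slope above [a / s] at all large [s] makes [f] grow by at least [a / 2] between [s] and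
    [2 * s]; repeated doubling contradicts boundedness. *)
Lemma dfn_not_steep f (B a : R) : dfnf S (fun e => f (e 0%N)) ->
  (forall x, `|f x| <= B) -> 0 < a ->
  ~ \forall s \near +oo, exists d : R, 0 < d /\
      forall h : R, 0 < h -> h < d -> a * h < s * (f (s + h) - f s).
Proof.
move=> df fB a0 steep; have cf := dfn_near_continuous df fB.
have [M [_ Mh]] := filterI steep cf.
have step s : M < s -> 0 < s -> a / 2 <= f (2 * s) - f s.
  move=> Ms s0; pose g x := f x - a / (2 * s) * x.
  (* On [[s, 2 s]] the slope [a / x] is at least [a / (2 * s)], so [f] minus the line of that slope
     is nondecreasing to the right. *)
  have c0 : 0 < a / (2 * s) by rewrite divr_gt0// mulr_gt0.
  have : g s <= g (2 * s).
    apply: right_nondecreasing_le; first by lra.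
      move=> x /andP[sx xs]; have [|_ cx] := Mh x; first by lra.
      apply: continuousB => //; apply: continuousM; [exact: cst_continuous|exact: cvg_id].
    move=> x /andP[sx xs]; have [|[d [d0 dh]] _] := Mh x; first by lra.
    near=> y; have xy : x < y by near: y; exact: nbhs_right_gt.
    have yd : y < x + d by near: y; apply: nbhs_right_lt; lra.
    have h : a * (y - x) < x * (f y - f x).
      by rewrite -[in f y](subrKC x y); apply: dh; lra.
    have x0 : 0 < x by lra.
    have : a / x * (y - x) < f y - f x by rewrite mulrAC ltr_pdivrMr// [_ * x]mulrC.
    have : a / (2 * s) * (y - x) <= a / x * (y - x).
      rewrite ler_pM2r ?subr_gt0// ler_pM2l// lef_pV2 ?posrE//; lra.
    rewrite /g; lra.
  rewrite /g; suff -> : a / (2 * s) * (2 * s) = a by move=> ?; have : a / (2 * s) * s = a / 2; [field; lra|lra].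
  by rewrite divfK//; lra.
(* Positive and beyond [M], hence so are all its doublings. *)
pose s0 := Num.max M 0 + 1.
have s0M : M < s0 /\ 0 < s0.
  have : M <= Num.max M 0 /\ 0 <= Num.max M 0 by rewrite !le_max !lexx orbT.
  by rewrite /s0; lra.
have pow k : s0 <= 2 ^+ k * s0.
  by rewrite ler_peMl ?exprn_ege1 ?ler1n//; lra.
have grow k : k%:R * (a / 2) <= f (2 ^+ k * s0) - f s0.
  elim: k => [|k IH]; first by rewrite mul0r expr0 mul1r subrr.
  have Msk : M < 2 ^+ k * s0 by have := pow k; lra.
  have : 0 < 2 ^+ k * s0 by have := pow k; lra.
  by move=> sk; have := step _ Msk sk; rewrite exprS -[2 * _ * s0]mulrA -[k.+1%:R]natr1; lra.
have [k kB] : exists k : nat, 2 * B + 1 < k%:R * (a / 2).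
  have [k _ /(_ k (leqnn k)) /= kB] := nbhs_infty_gtr ((2 * B + 1) / (a / 2)).
  by exists k; rewrite -ltr_pdivrMr// divr_gt0.
have := grow k; have := fB s0; have := fB (2 ^+ k * s0).
by rewrite !ler_norml => /andP[? ?] /andP[? ?] ?; lra.
Unshelve. all: by end_near. Qed.

(** Two dichotomies: the first, in [s], discards steepness by [dfn_not_steep]; the second, in [h] at
    a fixed [s], turns the failure of steepness into the inequality for all small [h]. *)
Lemma dfn_small_slope f (B a : R) : dfnf S (fun e => f (e 0%N)) ->
  (forall x, `|f x| <= B) -> 0 < a ->
  \forall s \near +oo, \forall h \near 0^'+, s * (f (s + h) - f s) <= a * h.
Proof.
move=> df fB a0.
pose P s := exists d : R, 0 < d /\
  forall h : R, 0 < h -> h < d -> a * h < s * (f (s + h) - f s).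
have dP : dfn S (fun e => P (e 0%N)).
  by rewrite /P; dfn_tac; apply: (dfnf_fun1 df); dfn_tac.
have [/(dfn_not_steep df fB a0)//|h] := dfn_germ_pinfty dP.
apply: filterS h => s nPs.
have dQ : dfn S (fun e => s * (f (s + e 0%N) - f s) <= a * e 0%N).
  by dfn_tac; apply: (dfnf_fun1 df); dfn_tac.
have [//|[d /= d0 dh]] := @dfn_germ_right
  (fun h => s * (f (s + h) - f s) <= a * h) 0 dQ.
exfalso; apply: nPs; exists d; split=> // h h0 hd.
rewrite ltNge; apply/negP; apply: dh => //.
by rewrite /ball /= sub0r normrN ger0_norm// ltW.
Qed.

End o_minimality.

(** * Definable selection *)

Section definable_vectors.
Context {R : realType} (S : omin_structure R).
Implicit Types e : nat -> R.

Lemma dfn_all_fin q (P : 'I_q -> (nat -> R) -> Prop) : (forall i, dfn S (P i)) ->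
  dfn S (fun e => forall i, P i e).
Proof.
move=> dP; pose Q k e := if insub k is Some i then P i e else True.
have dQ k : (k < q)%N -> dfn S (Q k).
  by move=> kq; rewrite /Q insubT.
apply: dfn_ext (dfn_all_lt dQ) => e; split=> h i; last first.
  by move=> iq; rewrite /Q insubT.
by have := h _ (ltn_ord i); rewrite /Q valK.
Qed.

Lemma dfn_allv q (P : (nat -> R) -> 'rV[R]_q -> Prop) :
  dfn S (fun e => P (fun k => e (q + k)%N) (\row_(i < q) e i)) ->
  dfn S (fun e => forall y, P e y).
Proof.
move=> /dfn_not/(@dfn_exv _ _ _ (fun e r => ~ P e r))/dfn_not.
apply: dfn_ext => e; rewrite -forallNP; split=> h r; last exact.
by apply: contrapT; exact: h.
Qed.

Lemma dfn_relv q (A : R -> 'rV[R]_q -> Prop) (h : (nat -> R) -> R) p :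
  dfn S (fun e => A (e 0%N) (\row_(i < q) e i.+1)) -> dfnf S h -> dfnv S p ->
  dfn S (fun e => A (h e) (p e)).
Proof.
move=> dA dh dp.
pose fs k := if k is k'.+1 then fun e => env_of (p e) k' else h.
have dfs k : dfnf S (fs k).
  case: k => [//|k]; have [kq|qk] := ltnP k q.
    by apply: dfnf_ext (dp (Ordinal kq)) => e; rewrite /= env_of_lt.
  by apply: dfnf_ext (dfnf_cst S 0) => e; rewrite /= env_of_ge.
apply: dfn_ext (dfn_comp dA dfs) => e.
rewrite /= (_ : \row__ _ = p e)//.
by apply/rowP => i; rewrite mxE env_ofE.
Qed.

Lemma dfnv_row q (s : nat -> nat) : dfnv S (fun e => \row_(i < q) e (s i)).
Proof. by move=> i; apply: dfnf_ext (dfnf_var S (s i)) => e; rewrite mxE. Qed.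

Lemma dfnv_row_mx q q' p p' : dfnv S p -> dfnv S p' ->
  dfnv S (fun e => row_mx (p e : 'rV[R]_q) (p' e : 'rV[R]_q')).
Proof.
by move=> dp dp' i; case: (split_ordP i) => j ->;
  [apply: dfnf_ext (dp j)|apply: dfnf_ext (dp' j)] => e;
  rewrite ?row_mxEl ?row_mxEr.
Qed.

Lemma dfnv_cst_mx q h : dfnf S h -> dfnv S (fun e => const_mx (h e) : 'rV[R]_q).
Proof. by move=> dh i; apply: dfnf_ext dh => e; rewrite mxE. Qed.

Lemma dfnv_scale q h p : dfnf S h -> dfnv S p -> dfnv S (fun e => h e *: p e : 'rV[R]_q).
Proof.
by move=> dh dp i; apply: dfnf_ext (dfnf_mul dh (dp i)) => e; rewrite !mxE.
Qed.

Lemma dfnv_add q p p' : dfnv S p -> dfnv S p' -> dfnv S (fun e => p e + p' e : 'rV[R]_q).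
Proof.
by move=> dp dp' i; apply: dfnf_ext (dfnf_add (dp i) (dp' i)) => e; rewrite !mxE.
Qed.

Lemma dfnv_cst q (v : 'rV[R]_q) : dfnv S (fun=> v).
Proof. move=> i; exact: dfnf_cst. Qed.

(* The selected point is the lexicographically smallest one of the fibre. *)
Lemma dfn_selection q (A : R -> set 'rV[R]_q) :
  dfn S (fun e => A (e 0%N) (\row_(i < q) e i.+1)) ->
  (forall s, A s !=set0) -> (forall s, compact (A s)) ->
  exists f : R -> 'rV[R]_q, (forall s, A s (f s)) /\ dfnv S (fun e => f (e 0%N)).
Proof.
elim: q A => [|q IH] A dA A0 cA.
  exists (fun=> 0); split=> [s|[]//].
  by have [y] := A0 s; rewrite (_ : 0 = y)//; apply/rowP => -[].
have /choice[m mP] : forall s, exists y, A s y /\ forall y', A s y' -> y 0 0 <= y' 0 0.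
  move=> s; have [|c] := @compact_EVT_min _ _ (fun y : 'rV[R]_q.+1 => y 0 0) _ (A0 s) (cA s).
    by apply: continuous_subspaceT => y; exact: coord_continuous.
  rewrite inE => Ac h; exists c; split=> // y Ay; apply: h; by rewrite inE.
pose g s := m s 0 0.
have dg : dfnf S (fun e => g (e 0%N)).
  (* First-order description of the graph of [g], the least first coordinate on the fibre. *)
  pose Q r s := exists y, (A s y /\ y 0 0 = r) /\ forall y', A s y' -> r <= y' 0 0.
  have dQ : dfn S (fun e => Q (e 0%N) (e 1%N)).
    rewrite /Q; apply: dfn_exv; apply: dfn_and; first apply: dfn_and.
    - apply: (dfn_relv dA); first exact: dfnf_var.
      exact: (dfnv_row id).
    - apply: dfn_eq; last exact: dfnf_var.
      exact: (dfnv_row id 0).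
    - apply: dfn_allv; apply: dfn_imp.
        apply: (dfn_relv dA); first exact: dfnf_var.
        exact: (dfnv_row id).
      apply: dfn_le; first exact: dfnf_var.
      exact: (dfnv_row id 0).
  apply: dfn_ext dQ => e; split=> [[y [[Ay <-] ymin]]|->].
    by apply/le_anti/andP; split; [exact/ymin/(mP _).1|exact: (mP _).2].
  by exists (m (e 1%N)); split; [split=> //; exact: (mP _).1|exact: (mP _).2].
(* The slice of least first coordinate; the induction hypothesis selects the remaining ones. *)
pose A' s : set 'rV_q := [set y | A s (row_mx (const_mx (g s) : 'rV_1) y)].
have [|s|s|f [fA df]] := IH A'.
- apply: (dfn_relv dA); first exact: dfnf_var.
  exact: (@dfnv_row_mx 1 q _ _ (dfnv_cst_mx dg) (dfnv_row succn)).
- exists (rsubmx (m s : 'rV_(1 + q))); rewrite /A' /=.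
  rewrite (_ : const_mx _ = lsubmx (m s : 'rV_(1 + q))); first by rewrite hsubmxK; exact: (mP _).1.
  by apply/rowP => i; rewrite ord1 !mxE; congr (m s _ _); exact/val_inj.
- rewrite (_ : A' s = (fun y : 'rV_(1 + q) => rsubmx y) @` (A s `&` [set y | y 0 0 = g s])).
    apply: continuous_compact.
      by apply: continuous_subspaceT => y; exact: continuous_rsubmx.
    apply: compact_closedI (cA s) _.
    apply: (@closed_comp _ _ (fun y : 'rV[R]_q.+1 => y 0 0) [set g s]) => [y _|].
      exact: coord_continuous.
    exact: closed_eq.
  apply/seteqP; split=> [y Ay|_ [y [Ay y0] <-]].
    exists (row_mx (const_mx (g s) : 'rV_1) y); last by rewrite row_mxKr.
    by split=> //=; rewrite mxE; case: splitP => // j _; rewrite mxE.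
  rewrite /A' /= (_ : const_mx _ = lsubmx (y : 'rV_(1 + q))) ?hsubmxK//.
  apply/rowP => i; rewrite ord1 !mxE -y0; congr (y _ _); exact/val_inj.
exists (fun s => row_mx (const_mx (g s) : 'rV_1) (f s)); split=> [s|]; first exact: fA.
exact: (@dfnv_row_mx 1 q _ _ (dfnv_cst_mx dg) df).
Qed.

(** The ball map is inverted algebraically: [w = ball_map z] gives [z = r *: w], where [r] is the
    positive solution of [r ^ 2 * (1 - |w| ^ 2) = 1], namely [sqrt (1 + |z| ^ 2)]. *)
Lemma dfn_globally_definable q (A : set 'rV[R]_q) : globally_definable S A ->
  dfn S (fun e => A (\row_(i < q) e i)).
Proof.
move=> /dfn_definable dB.
pose Q (z : 'rV[R]_q) := exists w, (ball_map @` A) w /\ exists r : R, (0 < r /\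
  r * r * (1 - \sum_(i < q) w 0 i * w 0 i) = 1) /\ forall i, z 0 i = r * w 0 i.
have dQ : dfn S (fun e => Q (\row_(i < q) e i)).
  rewrite /Q; apply: dfn_exv; apply: dfn_and.
    by apply: dfn_setv => //; exact: (dfnv_row id).
  apply: dfn_ex; apply: dfn_and; first apply: dfn_and.
  - by dfn_tac.
  - apply: dfn_eq; last exact: dfnf_cst.
    apply: dfnf_mul; first by dfn_tac.
    by dfn_tac; exact: (dfnv_row succn).
  - apply: dfn_all_fin => i; apply: dfn_eq.
      exact: (dfnv_row (addn q.+1)).
    apply: dfnf_mul; first exact: dfnf_var.
    exact: (dfnv_row succn).
have den (z : 'rV[R]_q) : exists d : R, [/\ 0 < d, d * d = 1 + \sum_(i < q) z 0 i * z 0 i &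
    ball_map z = d^-1 *: z].
  have z0 : 0 <= \sum_(i < q) z 0 i * z 0 i.
    by apply: sumr_ge0 => i _; rewrite -expr2 sqr_ge0.
  exists (Num.sqrt (1 + enorm z ^+ 2)); split=> //.
    by rewrite sqrtr_gt0 ltr_pwDl ?sqr_ge0.
  by rewrite -expr2 sqr_sqrtr ?addr_ge0 ?sqr_ge0// sqr_sqrtr.
apply: dfn_ext dQ => e; move: (\row__ _) => z; split=> [[_ [[z' Az' <-]]]|Az].
  have [d [d0 dd ->]] := den z'.
  move=> [r [[r0 rr] zr]]; suff -> : z = z' by [].
  have : r * r = d * d.
    move: rr; under eq_bigr do rewrite !mxE mulrACA -invfM dd.
    rewrite -mulr_sumr => rr; have : 1 + \sum_(i < q) z' 0 i * z' 0 i != 0.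
      by rewrite -dd mulf_neq0// gt_eqF.
    move: rr; rewrite dd; set t := \sum_(i < q) _ => rr t0.
    have -> : r * r = r * r * (1 - (1 + t)^-1 * t) * (1 + t) by field.
    by rewrite rr mul1r.
  rewrite -!expr2 => /eqP; rewrite eqrXn2 ?ltW// => /eqP rd.
  by apply/rowP => i; rewrite zr mxE rd mulVKf// gt_eqF.
have [d [d0 dd zd]] := den z; exists (ball_map z); split; first by exists z.
exists d; split; last by move=> i; rewrite zd mxE mulVKf// gt_eqF.
split=> //; rewrite zd; under eq_bigr do rewrite !mxE mulrACA -invfM dd.
rewrite -mulr_sumr dd; field; rewrite -dd mulf_neq0// gt_eqF//.
Qed.

Lemma dfnf_globally_definable n (F : 'rV[R]_n * R -> R) p h :
  globally_definable_fun S F -> dfnv S p -> dfnf S h ->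
  dfnf S (fun e => F (p e, h e)).
Proof.
move=> /dfn_globally_definable dF dp dh.
have dF' : dfnf S (fun e => F (\row_(i < n) e i, e n)).
  have := @dfn_setv _ _ _ _ (fun e => row_mx (row_mx (\row_(i < n) e i.+1)
    (const_mx (e n.+1))) (const_mx (e 0%N))) dF.
  have dr : dfnv S (fun e => row_mx (row_mx (\row_(i < n) e i.+1)
    (const_mx (e n.+1) : 'rV_1)) (const_mx (e 0%N) : 'rV_1)).
    apply: dfnv_row_mx; first apply: dfnv_row_mx.
    - exact: (dfnv_row succn).
    - by apply: dfnv_cst_mx; exact: dfnf_var.
    - by apply: dfnv_cst_mx; exact: dfnf_var.
  move=> /(_ dr); apply: dfn_ext => e; split=> /=.
    move=> [[x t] _ /= /eq_row_mx[/eq_row_mx[<- /rowP/(_ ord0)]]].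
    by rewrite !mxE => <- /rowP/(_ ord0); rewrite !mxE.
  by move=> ->; exists (\row_(i < n) e i.+1, e n.+1).
pose gs k e := if (k < n)%N then env_of (p e) k else h e.
have dgs k : dfnf S (gs k).
  rewrite /gs; case: ltnP => // kn.
  by apply: dfnf_ext (dp (Ordinal kn)) => e; rewrite env_of_lt.
apply: dfnf_ext (dfnf_comp dF' dgs) => e; rewrite /gs ltnn; congr (F (_, _)).
by apply/rowP => i; rewrite mxE ltn_ord env_ofE.
Qed.

End definable_vectors.

(** With positive increments and no division, the derivative is captured by a first-order
    formula. *)
Lemma derivable_right_approx (R : realType) (V : normedModType R) (F : V -> R)
    (p v : V) : derivable F p v ->
  forall eps : R, 0 < eps -> exists d : R, 0 < d /\ forall h : R, 0 < h -> h < d ->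
    `|F (p + h *: v) - F p - h * 'D_v F p| < eps * h.
Proof.
move=> /cvgrPdist_lt + eps e0 => /(_ _ e0).
rewrite near_withinE => -[d /= d0 dh]; exists d; split=> // h h0 hd.
have := dh h; rewrite /ball /= sub0r normrN ger0_norm ?ltW// => /(_ hd (lt0r_neq0 h0)).
rewrite -/('D_v F p) distrC -(ltr_pM2r h0); apply: le_lt_trans.
rewrite -[X in _ <= _ * X](ger0_norm (ltW h0)) -normrM mulrBl [h *: v + p]addrC.
rewrite [h * _]mulrC [_ *: _ * h](_ : _ = F (p + h *: v) - F p)//.
by rewrite /GRing.scale /= mulrAC mulVf ?mul1r// gt_eqF.
Qed.

(** * Definability of directional derivatives *)

Section definable_derivative.
Context {R : realType} (S : omin_structure R) (n : nat) (F : 'rV[R]_n * R -> R).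
Hypothesis dF : globally_definable_fun S F.

(** The formula [Q] holds for the derivative, and two values satisfying it differ by at most any
    [eps], as a common small increment [k] shows. *)
Lemma dfnf_derive (v : 'rV[R]_n * R) p h : (forall q, derivable F q v) ->
  dfnv S p -> dfnf S h -> dfnf S (fun e => 'D_v F (p e, h e)).
Proof.
move=> Fv dp dh.
pose Q y x t := forall eps : R, 0 < eps -> exists d : R, 0 < d /\ forall k : R, 0 < k -> k < d ->
    `|F (x + k *: v.1, t + k * v.2) - F (x, t) - k * y| < eps * k.
have QE y x t : Q y x t <-> y = 'D_v F (x, t).
  split=> [Qy|->]; last exact: derivable_right_approx.
  apply/eqP; rewrite -subr_eq0 -normr_le0; apply/ler_addgt0Pl => eps e0; rewrite addr0.
  have e2 : 0 < eps / 2 by rewrite divr_gt0.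
  have [d [d0 dP]] := Qy _ e2.
  have [d' [d'0 d'P]] := derivable_right_approx (Fv (x, t)) e2.
  pose k := Num.min d d' / 2.
  have m0 : 0 < Num.min d d' by rewrite lt_min d0.
  have [md md'] : Num.min d d' <= d /\ Num.min d d' <= d' by split; rewrite ge_min lexx ?orbT.
  have [k0 kd kd'] : [/\ 0 < k, k < d & k < d'] by rewrite /k; split; lra.
  rewrite -(ler_pM2r k0) -{1}(ger0_norm (ltW k0)) -normrM.
  have := dP _ k0 kd; have := d'P _ k0 kd'; rewrite [_ + k *: v](_ : _ = (x + k *: v.1, t + k * v.2))//.
  rewrite !ltr_norml => /andP[h1 h2] /andP[h3 h4].
  by rewrite ler_norml; apply/andP; split; lra.
have : dfn S (fun e => Q (e 0%N) (p (fun k => e k.+1)) (h (fun k => e k.+1))).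
  (* Under the three quantifiers, indices 0 to 3 hold [k], [d], [eps] and the value, so the
     arguments start at index 4. *)
  have dp' : dfnv S (fun e => p (fun k => e k.+4)).
    by move=> i; exact: (dfnf_comp (dp i) (fun k => dfnf_var S k.+4)).
  have dh' : dfnf S (fun e => h (fun k => e k.+4)).
    exact: (dfnf_comp dh (fun k => dfnf_var S k.+4)).
  rewrite /Q; dfn_tac; apply: dfnf_globally_definable => //.
    by apply: dfnv_add => //; apply: dfnv_scale; [exact: dfnf_var|exact: dfnv_cst].
  by dfn_tac.
by apply: dfn_ext => e; exact: QE.
Qed.

End definable_derivative.

(** * Euclidean norms *)

Lemma continuous_pair (T U V : topologicalType) (f : T -> U) (g : T -> V) :
  continuous f -> continuous g -> continuous (fun x => (f x, g x)).
Proof. move=> cf cg x; exact: (@cvg_pair _ _ _ _ _ _ _ _ _ _ _ (cf x) (cg x)). Qed.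

Section euclidean_norms.
Context {R : realType} {n : nat}.
Implicit Types (u v : 'rV[R]_n) (p : 'rV[R]_n * R).

Lemma dot_ge0 u : 0 <= dot u u.
Proof. by apply: sumr_ge0 => i _; rewrite -expr2 sqr_ge0. Qed.

Lemma enorm_ge0 u : 0 <= enorm u.
Proof. exact: sqrtr_ge0. Qed.

Lemma sqr_enorm u : enorm u ^+ 2 = dot u u.
Proof. by rewrite sqr_sqrtr ?dot_ge0. Qed.

Lemma dotC u v : dot u v = dot v u.
Proof. by apply: eq_bigr => i _; rewrite mulrC. Qed.

Lemma dotDr u v w : dot u (v + w) = dot u v + dot u w.
Proof. by rewrite /dot -big_split; apply: eq_bigr => i _; rewrite mxE mulrDr. Qed.

Lemma dotZr (a : R) u v : dot u (a *: v) = a * dot u v.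
Proof. by rewrite /dot mulr_sumr; apply: eq_bigr => i _; rewrite mxE mulrCA. Qed.

Lemma dotZl (a : R) u v : dot (a *: u) v = a * dot u v.
Proof. by rewrite dotC dotZr dotC. Qed.

Lemma dotBr u v w : dot u (v - w) = dot u v - dot u w.
Proof. by rewrite dotDr -scaleN1r dotZr mulN1r. Qed.

Lemma enormZ (a : R) u : enorm (a *: u) = `|a| * enorm u.
Proof. by rewrite /enorm dotZl dotZr mulrA -expr2 sqrtrM ?sqr_ge0// sqrtr_sqr. Qed.

Lemma enorm0 : enorm (0 : 'rV[R]_n) = 0.
Proof. by rewrite /enorm -(scale0r 0) dotZl mul0r sqrtr0. Qed.

Lemma coord_le_enorm u i : `|u 0 i| <= enorm u.
Proof.
rewrite -sqrtr_sqr ler_wsqrtr// /dot (bigD1 i)//= -expr2 lerDl.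
by apply: sumr_ge0 => j _; rewrite -expr2 sqr_ge0.
Qed.

Lemma enorm_eq0 u : enorm u = 0 -> u = 0.
Proof.
move=> u0; apply/rowP => i; rewrite mxE; apply/eqP.
by rewrite -normr_le0 -u0 coord_le_enorm.
Qed.

Lemma enorm_gt0 u : u != 0 -> 0 < enorm u.
Proof. by rewrite lt0r enorm_ge0 andbT; apply: contra_neq => /enorm_eq0. Qed.

(** A coordinatewise estimate suits the coordinatewise control of slopes and limits; the factor [n]
    is absorbed in later constants. *)
Lemma normr_dot_le u v (b : R) : 0 <= b -> (forall i, `|v 0 i| <= b) ->
  `|dot u v| <= n%:R * (enorm u * b).
Proof.
move=> b0 vb; apply: (le_trans (ler_norm_sum _ _ _)).
apply: (@le_trans _ _ (\sum_(i < n) enorm u * b)); last first.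
  by rewrite sumr_const card_ord mulr_natl.
apply: ler_sum => i _; by rewrite normrM ler_pM// coord_le_enorm.
Qed.

Lemma mx_norm_le u (b : R) : 0 <= b -> (forall i, `|u 0 i| <= b) -> `|u| <= b.
Proof.
move=> b0 ub; rewrite [leLHS]/Num.norm /= mx_normrE.
by apply: bigmax_le => // -[i j] _; rewrite ord1.
Qed.

Lemma enorm1_ge0 p : 0 <= enorm1 p.
Proof. exact: sqrtr_ge0. Qed.

Lemma sqr_enorm1 p : enorm1 p ^+ 2 = dot p.1 p.1 + p.2 ^+ 2.
Proof. by rewrite sqr_sqrtr /dot1 -?expr2// addr_ge0 ?dot_ge0 ?sqr_ge0. Qed.

Lemma enorm_le_enorm1 p : enorm p.1 <= enorm1 p.
Proof. by rewrite ler_wsqrtr// lerDl -expr2 sqr_ge0. Qed.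

Lemma snd_le_enorm1 p : `|p.2| <= enorm1 p.
Proof. by rewrite -sqrtr_sqr ler_wsqrtr// expr2 lerDr dot_ge0. Qed.

Lemma enorm1_gt0 p : p != 0 -> 0 < enorm1 p.
Proof.
rewrite lt0r enorm1_ge0 andbT; apply: contra_neq => p0.
have := enorm_le_enorm1 p; have := snd_le_enorm1 p; rewrite p0 normr_le0 => /eqP p2.
move=> p1; have /enorm_eq0 : enorm p.1 = 0 by apply/le_anti; rewrite p1 enorm_ge0.
by case: p p2 {p0 p1} => x t /= -> ->.
Qed.

End euclidean_norms.

(** * Radial points *)

(** By [enorm1_grad_t] it suffices to clear the denominator, which is positive since 0 is a regular
    value. *)
Lemma malgrange_dF (R : realType) n (F : 'rV[R]_n * R -> R) c :
  regular_value_of F 0 -> malgrange F c ->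
  exists rho eps A : R, [/\ 0 < rho, 0 < eps & 0 < A] /\
    forall p, hsurf F p -> rho < enorm p.1 -> `|p.2 - c| < eps ->
      A * enorm1 (nabla F p) <= enorm p.1 * enorm (dF_x F p).
Proof.
move=> reg [rho [eps [A [pos h]]]]; exists rho, eps, A; split=> // p Mp rp ep.
have := h p Mp rp ep; rewrite enorm1_grad_t; last exact: reg.
by rewrite mulrA ler_pdivlMr// enorm1_gt0//; exact: reg.
Qed.

Lemma differentiable_approx (R : realType) (V : normedModType R) (F : V -> R) p :
  differentiable F p -> forall k : R, 0 < k -> exists r : R, 0 < r /\
  forall h, `|h| < r -> `|F (p + h) - F p - 'D_h F p| <= k * `|h|.
Proof.
move=> dF k k0; have /diff_locallyP[_ /eqaddoP/(_ k k0)] := dF.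
move=> /nbhs_ballP[r /= r0 rP]; exists r; split=> // h hr.
rewrite deriveE//; have := rP h; rewrite -ball_normE /= sub0r normrN => /(_ hr).
by rewrite -[(_ - _) h]/(F (h + p) - (F p + 'd F p h)) opprD addrA [h + p]addrC.
Qed.

Section radial_points.
Context {R : realType} (S : omin_structure R) {n : nat}.
Variable F : 'rV[R]_n * R -> R.
Hypothesis defF : globally_definable_fun S F.
Hypothesis diffF : forall p, differentiable F p.
Hypothesis contDF : forall v, continuous ('D_v F).
Implicit Types (y : 'rV[R]_(n + 1)) (s t c eps delta : R).

(** The first [n] coordinates of [y] are the direction, the last one is the level [t]. *)
Definition pt s y : 'rV[R]_n * R := (s *: lsubmx y, y 0 (rshift n ord0)).

(* Points of the hypersurface in polar coordinates [(s, theta)] at which the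
   angle between the normal and the radial direction stays away from [pi / 2]. *)
Definition radial delta c eps s : set 'rV[R]_(n + 1) :=
  [set y | (dot (lsubmx y) (lsubmx y) = 1 /\ F (pt s y) = 0) /\
    (`|y 0 (rshift n ord0) - c| <= eps /\
     delta * delta * dot (dF_x F (pt s y)) (dF_x F (pt s y)) <=
     dot (dF_x F (pt s y)) (lsubmx y) * dot (dF_x F (pt s y)) (lsubmx y))].

(** The angle condition is squared, hence polynomial in the direction and in the partial
    derivatives, which [dfnf_derive] makes definable. *)
Lemma dfn_radial delta c eps :
  dfn S (fun e => radial delta c eps (e 0%N) (\row_(i < n + 1) e i.+1)).
Proof.
have dl : dfnv S (fun e => lsubmx (\row_(i < n + 1) e i.+1)).
  by move=> i; apply: dfnf_ext (dfnv_row S succn (lshift 1 i)) => e; rewrite !mxE.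
have dr : dfnf S (fun e => (\row_(i < n + 1) e i.+1) 0 (rshift n ord0)).
  exact: (dfnv_row S succn).
have dx : dfnv S (fun e => e 0%N *: lsubmx (\row_(i < n + 1) e i.+1)).
  by apply: dfnv_scale => //; exact: dfnf_var.
have dD i : dfnf S (fun e => dF_x F (pt (e 0%N) (\row_(i < n + 1) e i.+1)) 0 i).
  have dv q : derivable F q (delta_mx 0 i, 0) by exact: diff_derivable.
  by apply: dfnf_ext (dfnf_derive defF dv dx dr) => e; rewrite [RHS]mxE.
rewrite /radial; apply: dfn_and; apply: dfn_and.
- by rewrite /dot; dfn_tac; exact: dl.
- by apply: dfn_eq; [exact: (dfnf_globally_definable defF dx dr)|exact: dfnf_cst].
- have := dfn_and (dfn_le (dfnf_cst _ (- eps)) (dfnf_sub dr (dfnf_cst _ c)))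
    (dfn_le (dfnf_sub dr (dfnf_cst _ c)) (dfnf_cst _ eps)).
  by apply: dfn_ext => e; rewrite ler_norml; split=> /andP.
- by rewrite /dot; dfn_tac; first [exact: dD|exact: dl].
Qed.

(** The bound is uniform in [s]: it serves for compactness and for boundedness of the selected
    curve. *)
Lemma radial_coord_le delta c eps s y i : radial delta c eps s y ->
  `|y 0 i| <= 1 + `|c| + eps.
Proof.
move=> [[y1 _] [yt _]]; have eps0 : 0 <= eps := le_trans (normr_ge0 _) yt.
case: (split_ordP i) => j ->.
  have := coord_le_enorm (lsubmx y) j; rewrite mxE => /le_trans; apply.
  by rewrite /enorm y1 sqrtr1 -addrA lerDl addr_ge0.
rewrite ord1 -[y 0 _](subrK c) (le_trans (ler_normD _ _))//.
have := normr_ge0 c; lra.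
Qed.

(** All the conditions are closed, by continuity of [F] and of its partial derivatives. *)
Lemma compact_radial delta c eps s : compact (radial delta c eps s).
Proof.
apply: bounded_closed_compact.
  exists (1 + `|c| + eps); split; first exact: num_real.
  move=> B /ltW ltB y Ey; apply: mx_norm_le => [|i].
    exact: le_trans (le_trans (normr_ge0 _) (radial_coord_le (rshift n ord0) Ey)) ltB.
  exact: le_trans (radial_coord_le i Ey) ltB.
have cl i : continuous (fun y => lsubmx y 0 i).
  rewrite (_ : (fun y => _) = fun y => y 0 (lshift 1 i)).
    by move=> y; exact: coord_continuous.
  by apply/funext => y; rewrite mxE.
have cr : continuous (fun y => y 0 (rshift n ord0)).
  by move=> y; exact: coord_continuous.
have cp : continuous (pt s).
  apply: continuous_pair => // y.
  by apply: cvgZr; [exact: nbhs_filter|exact: continuous_lsubmx].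
have cF : continuous (fun y => F (pt s y)).
  move=> y; apply: (@continuous_comp _ _ _ (pt s) F); first exact: cp.
  exact: differentiable_continuous.
have cD i : continuous (fun y => dF_x F (pt s y) 0 i).
  rewrite (_ : (fun y => _) = fun y => 'D_(delta_mx 0 i, 0) F (pt s y)).
    move=> y; apply: (@continuous_comp _ _ _ (pt s) ('D_(delta_mx 0 i, 0) F)).
      exact: cp.
    exact: contDF.
  by apply/funext => y; rewrite mxE.
have cdot (f g : 'rV[R]_(n + 1) -> 'rV[R]_n) : (forall i, continuous (fun y => f y 0 i)) ->
    (forall i, continuous (fun y => g y 0 i)) -> continuous (fun y => dot (f y) (g y)).
  move=> cf cg; apply: continuous_big => [|i _ y]; first exact: add_continuous.
  by apply: continuousM; [exact: cf|exact: cg].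
rewrite /radial; apply: closedI; apply: closedI.
- apply: (@closed_comp _ _ (fun y => dot (lsubmx y) (lsubmx y)) [set 1]) => [y _|].
    exact: cdot.
  exact: closed_eq.
- apply: (@closed_comp _ _ (fun y => F (pt s y)) [set 0]) => [y _|].
    exact: cF.
  exact: closed_eq.
- apply: (@closed_comp _ _ (fun y => `|y 0 (rshift n ord0) - c|) [set x | x <= eps]) => [y _|].
    apply: (@continuous_comp _ _ _ (fun y => y 0 (rshift n ord0) - c) Num.norm).
      by apply: continuousB; [exact: cr|exact: cst_continuous].
    exact: norm_continuous.
  exact: closed_le.
- pose fA y := dot (dF_x F (pt s y)) (lsubmx y).
  pose fB y := dot (dF_x F (pt s y)) (dF_x F (pt s y)).
  have cA : continuous fA by exact: cdot.
  have cB : continuous fB by exact: cdot.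
  have cg : continuous (fun y => fA y * fA y - delta * delta * fB y).
    move=> y; apply: (@continuousB _ _ _ (fun y => fA y * fA y) (fun y => delta * delta * fB y)).
      by apply: continuousM; exact: cA.
    by apply: continuousM; [exact: cst_continuous|exact: cB].
  rewrite (_ : (fun y => _) = (fun y => fA y * fA y - delta * delta * fB y)
     @^-1` [set x | 0 <= x]).
    by apply: closed_comp => [y _|]; [exact: cg|exact: closed_ge].
  by apply/funext => y; rewrite /= subr_ge0.
Qed.

End radial_points.

(** * Absence of radial points at large radii *)

Section radial_points_far_away.
Context {R : realType} (S : omin_structure R) {n : nat}.
Variable F : 'rV[R]_n * R -> R.
Hypothesis defF : globally_definable_fun S F.
Hypothesis diffF : forall p, differentiable F p.
Hypothesis contDF : forall v, continuous ('D_v F).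
Hypothesis regF : regular_value_of F 0.

Lemma dfnv_small_slope q (f : R -> 'rV[R]_q) (B a : R) :
  dfnv S (fun e => f (e 0%N)) -> (forall x i, `|f x 0 i| <= B) -> 0 < a ->
  \forall s \near +oo, \forall h \near 0^'+,
    forall i, `|s * (f (s + h) 0 i - f s 0 i)| <= a * h.
Proof.
move=> df fB a0.
have : \forall s \near +oo, forall i, \forall h \near 0^'+,
    `|s * (f (s + h) 0 i - f s 0 i)| <= a * h.
  apply: filter_forall => i.
  have := @dfn_small_slope _ S (fun x => f x 0 i) B a (df i) (fun x => fB x i) a0.
  have := @dfn_small_slope _ S (fun x => - f x 0 i) B a (dfnf_opp (df i)).
  have fNB x : `|- f x 0 i| <= B by rewrite normrN.
  move=> /(_ fNB a0); apply: filterS2 => s; apply: filterS2 => h h1 h2.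
  by rewrite ler_norml; apply/andP; split; lra.
by apply: filterS => s hs; exact: filter_forall.
Qed.

(** Otherwise all large radii carry radial points, by the dichotomy at infinity. Finite increments
    along a selected definable curve take the place of its derivative: they give
    [|X| <= 3 / 4 * delta * N], against [|X| >= delta * N]. *)
Lemma radial_eventually_empty (rho eps A c delta : R) :
  0 < eps -> 0 < A -> 0 < delta ->
  (forall p, hsurf F p -> rho < enorm p.1 -> `|p.2 - c| < eps ->
    A * enorm1 (nabla F p) <= enorm p.1 * enorm (dF_x F p)) ->
  \forall s \near +oo, ~ (radial F delta c (eps / 2) s !=set0).
Proof.
move=> eps0 A0 delta0 mal; pose E s := radial F delta c (eps / 2) s.
have dE : dfn S (fun e => E (e 0%N) (\row_(i < n + 1) e i.+1)) by exact: dfn_radial.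
have dN : dfn S (fun e => E (e 0%N) !=set0).
  by apply: dfn_exv; apply: (dfn_relv dE); [exact: dfnf_var|exact: (dfnv_row S id)].
have [[M [_ EM]]|//] := @dfn_germ_pinfty _ S (fun s => E s !=set0) dN; exfalso.
(* Selection needs nonempty compact fibres for every [s]; up to [M] the fibre is replaced by the
   origin. *)
pose E' s : set 'rV_(n + 1) := [set y | (M < s /\ E s y) \/ (s <= M /\ y = 0)].
have [||s|f [fE' df]] := @dfn_selection _ S _ E'.
- apply: dfn_or; apply: dfn_and; try by dfn_tac.
  apply: dfn_ext (@dfn_all_fin _ S _ (fun i e => e (i.+1) = 0) _) => [e|i].
    split=> [h|/rowP h i]; last by have := h i; rewrite !mxE.
    by apply/rowP => i; rewrite !mxE.
  by dfn_tac.
- move=> s; have [sM|Ms] := leP s M; first by exists 0; right.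
  by have [y Ey] := EM s Ms; exists y; left.
- have [sM|Ms] := leP s M.
    rewrite (_ : E' s = [set 0]); first exact: compact_set1.
    apply/seteqP; split=> y; last by right.
    by move=> [[]|[]//]; rewrite ltNge sM.
  rewrite (_ : E' s = E s); first exact: compact_radial.
  apply/seteqP; split=> y; last by left.
  by move=> [[]//|[]]; rewrite leNgt Ms.
have fE s : M < s -> E s (f s).
  by move=> Ms; case: (fE' s) => -[//]; rewrite leNgt Ms.
pose B := 1 + `|c| + eps / 2.
have B0 : 0 <= B by rewrite /B; have := normr_ge0 c; lra.
have fB s i : `|f s 0 i| <= B.
  have [[_ /radial_coord_le]|[_ ->]] := fE' s; first exact.
  by rewrite mxE normr0.
(* Chosen so that the errors [2 * n * N * a * h] from the direction and [N * a * h / A] from the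
   level add up to [delta / 2 * N * h]. *)
pose a := delta / 2 / (2 * n%:R + A^-1).
have D0 : 0 < 2 * n%:R + A^-1 :> R by rewrite ltr_wpDl ?mulr_ge0// invr_gt0.
have a0 : 0 < a by rewrite !divr_gt0.
have aD : a * (2 * n%:R + A^-1) = delta / 2 by rewrite /a divfK// gt_eqF.
have slopes := dfnv_small_slope df fB a0.
have [s [[Ms rs s1] slope]] : exists s : R, [/\ M < s, rho < s & 1 <= s] /\
    \forall h \near 0^'+, forall i, `|s * (f (s + h) 0 i - f s 0 i)| <= a * h.
  near (pinfty_nbhs R) => s; exists s; split; last by near: s.
  split; near: s.
  - by have := nbhs_pinfty_gt (num_real M).
  - by have := nbhs_pinfty_gt (num_real rho).
  - by have := nbhs_pinfty_ge (num_real (1 : R)).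
have s0 : 0 < s := lt_le_trans ltr01 s1.
pose p := pt s (f s); pose theta := lsubmx (f s).
have [[theta1 Fp] [tc radp]] := fE s Ms; rewrite -/p -/theta in theta1 Fp radp.
have etheta : enorm theta = 1 by rewrite /enorm theta1 sqrtr1.
have ep : enorm p.1 = s by rewrite enormZ etheta mulr1 (ger0_norm (ltW s0)).
pose N := enorm (dF_x F p); have nabla0 : nabla F p != 0 by exact: regF.
have malp : A * enorm1 (nabla F p) <= s * N.
  rewrite -ep; apply: mal => //; first by rewrite ep.
  by apply: (le_lt_trans tc); lra.
(* Malgrange's inequality forces [dF_x] to be nonzero, as [nabla F] is. *)
have N0 : 0 < N.
  by rewrite -(pmulr_rgt0 _ s0); apply: lt_le_trans malp; rewrite mulr_gt0// enorm1_gt0.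
pose X := dot (dF_x F p) theta.
have Xd : delta * N <= `|X|.
  have dN0 : 0 <= delta * N by rewrite mulr_ge0 ?ltW.
  rewrite -(ler_pXn2r (ltn0Sn 1)) ?nnegrE//.
  rewrite exprMn sqr_enorm real_normK ?num_real// !expr2; exact: radp.
(* The increment has norm at most [(1 + a) * h], so this precision makes the Taylor remainder at
   most [delta * N / 4 * h]. *)
pose k0 := delta * N / 4 / (1 + a).
have k00 : 0 < k0 by rewrite !divr_gt0// ?mulr_gt0// addr_gt0.
have [r [r0 approx]] := differentiable_approx (diffF p) k00.
have [h [h0 hs hr slopeh]] : exists h : R, [/\ 0 < h, h <= s, (1 + a) * h < r &
    forall i, `|s * (f (s + h) 0 i - f s 0 i)| <= a * h].
  near (0 : R)^'+ => h; exists h; split; near: h => //.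
  - exact: nbhs_right_gt.
  - exact: nbhs_right_le.
  - have ra0 : 0 < r / (1 + a) by rewrite divr_gt0// addr_gt0.
    by apply: filterS (nbhs_right_lt ra0) => h; rewrite ltr_pdivlMr ?addr_gt0// mulrC.
have Df i : `|f (s + h) 0 i - f s 0 i| <= a * h / s.
  by have := slopeh i; rewrite normrM (ger0_norm (ltW s0)) ler_pdivlMr// mulrC.
have ahs0 : 0 <= a * h / s by apply: divr_ge0; [apply: mulr_ge0|]; exact: ltW.
have ahs : a * h / s <= a * h.
  by rewrite ler_pdivrMr// ler_peMr// mulr_ge0 ?ltW.
have Msh : M < s + h by lra.
have [[_ Fq] _] := fE _ Msh.
pose dtheta := lsubmx (f (s + h)) - theta.
pose dt := f (s + h) 0 (rshift n ord0) - f s 0 (rshift n ord0).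
have dthetaE i : dtheta 0 i = f (s + h) 0 (lshift 1 i) - f s 0 (lshift 1 i).
  by rewrite !mxE.
have thetaE i : theta 0 i = f s 0 (lshift 1 i) by rewrite mxE.
(* The increment of the curve, from [(s + h) theta' - s theta = h theta + (s + h) (theta' -
   theta)]. *)
pose k : 'rV[R]_n * R := (h *: theta + (s + h) *: dtheta, dt).
have pk : p + k = pt (s + h) (f (s + h)).
  congr (_, _); rewrite /= /dt ?subrKC// /dtheta.
  by apply/rowP => i; rewrite !mxE; ring.
have nk : `|k| <= (1 + a) * h.
  rewrite [leLHS]/Num.norm /= ge_max; apply/andP; split; last first.
    apply: (le_trans (Df _)); apply: (le_trans ahs); lra.
  apply: mx_norm_le => [|i]; first by rewrite mulr_ge0 ?addr_ge0 ?ltW.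
  rewrite mxE [X in X + _]mxE [X in _ + X]mxE dthetaE thetaE.
  have := slopeh (lshift 1 i); have := coord_le_enorm (lsubmx (f (s + h))) i.
  have [[q1 _] _] := fE _ Msh; rewrite /enorm q1 sqrtr1 mxE => q1' sl.
  rewrite [X in `|X|](_ : _ = h * f (s + h) 0 (lshift 1 i) +
    s * (f (s + h) 0 (lshift 1 i) - f s 0 (lshift 1 i))); last by ring.
  rewrite (le_trans (ler_normD _ _))// mulrDl mul1r lerD// normrM (ger0_norm (ltW h0)).
  by rewrite ler_piMr// ltW.
(* [F] vanishes at both ends of the increment, so the differential equals the remainder up to
   sign. *)
have : `|'D_k F p| <= delta * N / 4 * h.
  have /approx : `|k| < r := le_lt_trans nk hr.
  rewrite pk Fq Fp subrr sub0r normrN => /le_trans; apply.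
  have -> : delta * N / 4 * h = k0 * ((1 + a) * h).
    by rewrite /k0; field; lra.
  by rewrite ler_pM2l.
rewrite derive_nabla// /dot1 /= dotDr !dotZr -/X => Dk.
pose Y := dot (dF_x F p) dtheta.
(* Since [h <= s], the factor [s + h] is at most [2 * s], which cancels the [1 / s] in the slope
   bound. *)
have Yle : `|(s + h) * Y| <= 2 * n%:R * N * a * h.
  have : `|Y| <= n%:R * (N * (a * h / s)).
    apply: normr_dot_le => [|i]; last by rewrite dthetaE.
    exact: ahs0.
  rewrite normrM ger0_norm; last lra.
  move=> Yle; apply: (@le_trans _ _ ((2 * s) * (n%:R * (N * (a * h / s))))).
    by apply: ler_pM => //; lra.
  rewrite le_eqVlt; apply/orP; left; apply/eqP; field; lra.
(* Here Malgrange's condition is decisive: [|dF_t| <= |nabla F| <= s * N / A], and the factor [s]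
   cancels the [1 / s] in the slope bound. *)
have tle : `|dF_t F p * dt| <= N * a * h / A.
  have : `|dF_t F p * dt| <= enorm1 (nabla F p) * (a * h / s).
    rewrite normrM ler_pM//; [exact: (snd_le_enorm1 (nabla F p))|exact: Df].
  move=> /le_trans; apply.
  rewrite (_ : N * a * h / A = (s * N / A) * (a * h / s)); last by field; lra.
  rewrite ler_wpM2r//.
  by rewrite ler_pdivlMr// mulrC.
have hX : h * `|X| <= `|h * X + (s + h) * Y + dF_t F p * dt| + `|(s + h) * Y| + `|dF_t F p * dt|.
  rewrite -{1}(ger0_norm (ltW h0)) -normrM.
  rewrite [X in `|X|](_ : _ = h * X + (s + h) * Y + dF_t F p * dt - (s + h) * Y - dF_t F p * dt); last by ring.
  by rewrite (le_trans (ler_normB _ _))// lerD2r ler_normB.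
have hXd : h * (delta * N) <= h * `|X| by rewrite ler_pM2l.
have E1 : 2 * n%:R * N * a * h + N * a * h / A = delta / 2 * N * h.
  by rewrite -aD; ring.
have : 0 < delta * N * h by rewrite !mulr_gt0.
rewrite -/Y in Dk; lra.
Unshelve. all: by end_near. Qed.

End radial_points_far_away.

(** * Malgrange's condition, sphericalness and equisingularity *)

(** A cluster point of an ultrafilter is a limit; this replaces the extraction of subsequences. *)
Lemma ultra_cvg_compact (T : Type) (X : topologicalType) (A : set X) (f : T -> X)
    (U : set_system T) : UltraFilter U -> compact A -> (forall t, A (f t)) ->
  exists2 x, A x & f t @[t --> U] --> x.
Proof.
move=> UU cA fA; have UA : (f @ U) A by exact: filterE fA.
have [x [Ax clx]] := cA (f @ U) _ UA; exists x => // B xB.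
have [//|nB] := in_ultra_setVsetC (f @^-1` B) UU.
by have [y [By nBy]] := clx (~` B) B nB xB.
Qed.

Section malgrange_condition.
Context {R : realType} {n : nat}.
Variable F : 'rV[R]_n * R -> R.
Hypothesis diffF : forall p, differentiable F p.
Hypothesis regF : regular_value_of F 0.

(** If [v] is not orthogonal to [u], some far point of the sequence is radial with
    [delta = |<v, u>| / 2], at a radius where [radial_eventually_empty] forbids it. *)
Lemma malgrange_horizontally_spherical (S : omin_structure R) c :
  globally_definable_fun S F -> (forall v, continuous ('D_v F)) ->
  malgrange F c -> horizontally_spherical F c.
Proof.
move=> defF contDF /(malgrange_dF regF)[rho [eps [A [[rho0 eps0 A0] mal]]]].
move=> p u Mp _ pu v clv; apply/eqP/negPn/negP => vu.
pose L := `|dot v (set_val u)|; have L0 : 0 < L by rewrite normr_gt0.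
have L20 : 0 < L / 2 by rewrite divr_gt0.
have := radial_eventually_empty defF diffF contDF regF eps0 A0 L20 mal.
move=> [M [_ empty]].
have pu' : (at_fin \o p) @ \oo --> filter_prod (nbhs (inr u : sphc R n)) (nbhs c).
  exact: pu.
have [enoo thu] : enorm (p k).1 @[k --> \oo] --> +oo /\
    (enorm (p k).1)^-1 *: (p k).1 @[k --> \oo] --> set_val u.
  apply/cvg_sphc_inr; exact: (cvg_comp (at_fin \o p) fst pu' cvg_fst).
have tc : (p k).2 @[k --> \oo] --> c.
  exact: (cvg_comp (at_fin \o p) snd pu' cvg_snd).
pose theta k := (enorm (p k).1)^-1 *: (p k).1.
pose nn k := (enorm (nu_x F (p k)))^-1 *: nu_x F (p k).
(* Makes [n * b] at most [L / 4]; the denominator is [n.+1] to be positive. *)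
pose b := L / 4 / n.+1%:R.
have b0 : 0 < b by rewrite !divr_gt0.
pose G := [set k | [/\ M < enorm (p k).1, 0 < enorm (p k).1,
  `|c - (p k).2| < eps / 2 & forall i, `|set_val u 0 i - theta k 0 i| < b]].
have nearG : \forall k \near \oo, G k.
  near=> k; split; near: k.
  - exact: (cvgryPgt _).1 enoo M.
  - exact: (cvgryPgt _).1 enoo 0.
  - by move/cvgrPdist_lt : tc; apply; rewrite divr_gt0.
  - apply: filter_forall => i.
    have : theta k 0 i @[k --> \oo] --> set_val u 0 i.
      by apply: (cvg_comp theta (fun y : 'rV[R]_n => y 0 i) thu); exact: coord_continuous.
    by move/cvgrPdist_lt; apply.
have cdot : {for v, continuous (fun y => dot y (set_val u))}.
  apply: continuous_big => [|i _ y]; first exact: add_continuous.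
  by apply: continuousM; [exact: coord_continuous|exact: cst_continuous].
have nv : \forall y \near v, `|dot v (set_val u) - dot y (set_val u)| < L / 4.
  by move/cvgrPdist_lt : cdot; apply; rewrite divr_gt0.
have [_ [[k [Mk xk tk thk] <-] kv]] : (nn @` G) `&`
    [set y | `|dot v (set_val u) - dot y (set_val u)| < L / 4] !=set0.
  by apply: clv nv; apply: filterS nearG => k Gk; exists k.
(* Only an inequality, since [nn k] is 0 where [nu_x] vanishes. *)
have n1 : enorm (nn k) <= 1.
  rewrite enormZ ger0_norm ?invr_ge0 ?enorm_ge0//.
  have [->|w0] := eqVneq (enorm (nu_x F (p k))) 0; first by rewrite invr0 mul0r.
  by rewrite mulVf.
(* Passing from [v] to [nn k] costs [L / 4], and from [u] to [theta k] another [L / 4]. *)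
have dL : L / 2 <= `|dot (nn k) (theta k)|.
  have : `|dot (nn k) (set_val u - theta k)| <= n%:R * (1 * b).
    apply: (@le_trans _ _ (n%:R * (enorm (nn k) * b))).
      apply: normr_dot_le => [|i]; first exact: ltW.
      by have := ltW (thk i); rewrite !mxE.
    by rewrite ler_wpM2l// ler_wpM2r// ltW.
  have : n%:R * (1 * b) <= L / 4.
    rewrite mul1r /b mulrA ler_pdivrMr// mulrC ler_wpM2l ?divr_ge0 ?ltW//.
    by rewrite ltr_nat.
  rewrite dotBr; move: kv; rewrite /= -/(nn k) /L.
  move: (dot v _) (dot (nn k) _) (dot (nn k) _) => d1 d2 d3.
  have := ler_normD (d1 - d3) d3; have := ler_normD (d3 - d2) d2.
  rewrite !subrK; lra.
have xp : enorm (p k).1 *: theta k = (p k).1.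
  by rewrite scalerA mulfV ?scale1r// gt_eqF.
pose s := enorm (p k).1; pose y := row_mx (theta k) (const_mx (p k).2 : 'rV_1).
have thy : lsubmx y = theta k by rewrite row_mxKl.
have ty : y 0 (rshift n ord0) = (p k).2 by rewrite row_mxEr mxE.
have py : pt s y = p k by rewrite /pt thy ty xp -surjective_pairing.
case: (empty s Mk); exists y; rewrite /radial /= thy ty py.
split; split.
- rewrite -sqr_enorm enormZ ger0_norm ?invr_ge0 ?enorm_ge0//.
  by rewrite mulVf ?expr1n// gt_eqF.
- exact: Mp.
- by rewrite distrC ltW.
(* By [dL] the vector [nu_x] is nonzero here, so [nn k] spans the line of [dF_x]. *)
have [l dFl] : exists l, dF_x F (p k) = l *: nn k.
  exists (enorm1 (nabla F (p k)) * enorm (nu_x F (p k))).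
  rewrite /nn scalerA -mulrA.
  have w0 : nu_x F (p k) != 0.
    apply/eqP => w0; move: dL; rewrite /nn w0 scaler0 -(scale0r 0) dotZl mul0r normr0; lra.
  rewrite mulfV ?gt_eqF ?enorm_gt0// mulr1 /nu_x /nu /= scalerA.
  by rewrite mulfV ?scale1r// gt_eqF// enorm1_gt0//; exact/regF/Mp.
have nn1 : dot (nn k) (nn k) <= 1.
  by rewrite -sqr_enorm expr_le1 ?enorm_ge0.
have dL2 : L / 2 * (L / 2) <= dot (nn k) (theta k) * dot (nn k) (theta k).
  rewrite -!expr2 -[leRHS]real_normK ?num_real//.
  by rewrite ler_pXn2r ?nnegrE//; exact: ltW.
have l2 : 0 <= l * l by rewrite -expr2 sqr_ge0.
rewrite dFl; move: (nn k) (theta k) nn1 dL2 => e th nn1 dL2.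
rewrite !(dotZl, dotZr) [leRHS](_ : _ = l * l * (dot e th * dot e th)); last by ring.
rewrite [leLHS](_ : _ = l * l * (L / 2 * (L / 2) * dot e e)); last by ring.
apply: ler_wpM2l => //; apply: le_trans dL2.
by rewrite ler_piMr// -expr2 sqr_ge0.
Unshelve. all: by end_near. Qed.

(** * Equisingularity implies Malgrange's condition *)

Lemma compact_sphere : compact (sphere R n).
Proof.
apply: bounded_closed_compact.
  exists 1; split; first exact: num_real.
  move=> B /ltW B1 y /= y1; apply: le_trans B1; apply: mx_norm_le => // i.
  by rewrite -y1 coord_le_enorm.
have cd : continuous (fun y : 'rV[R]_n => dot y y).
  apply: continuous_big => [|i _ y]; first exact: add_continuous.
  by apply: continuousM; exact: coord_continuous.
rewrite (_ : sphere R n = (fun y => dot y y) @^-1` [set 1]).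
  by apply: closed_comp => [y _|]; [exact: cd|exact: closed_eq].
apply/seteqP; split=> y /= y1; first by rewrite -sqr_enorm y1 expr1n.
by rewrite /sphere /= /enorm y1 sqrtr1.
Qed.

(** As [dF_t] is nonzero, the radial direction lifts to a tangent vector, along which the radius has
    derivative [|x|]. *)
Lemma radius_regular_dF_t p : hsurf F p -> p.1 != 0 -> dF_t F p != 0 ->
  radius_regular F p.
Proof.
move=> Mp p0 t0; split=> //.
exists (p.1, - dot (dF_x F p) p.1 / dF_t F p).
  rewrite /tangent /= derive_nabla// /dot1 /=.
  by rewrite mulrC divfK// subrr.
set w := (_, _); suff -> : 'D_w (@Defs.radius R n) p = enorm p.1 by rewrite gt_eqF ?enorm_gt0.
have cst : (fun=> enorm p.1) @ (0 : R)^' --> enorm p.1 by exact: cvg_cst.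
apply: cvg_lim => //; apply: cvg_trans cst.
apply: near_eq_cvg; rewrite near_withinE; near=> h => h0.
have h1 : `|h| < 1.
  by near: h; exists 1 => //= x; rewrite /ball /= sub0r normrN.
move: h1; rewrite ltr_norml => /andP[h1 _].
have hwp : (h *: w + p).1 = (1 + h) *: p.1 by rewrite scalerDl scale1r addrC.
rewrite /= /Defs.radius hwp enormZ ger0_norm; last lra.
by rewrite mulrDl mul1r [_ + h * _]addrC addrK /GRing.scale /= mulKf.
Unshelve. all: by end_near. Qed.

(** Failure of Malgrange's condition with constants [k + 2] and [1 / (k + 2)] gives points tending
    to some [(u, c)] at infinity, where the conormal lines of the hypersurface tend to the line of
    [dt]. *)
Lemma t_equisingular_malgrange c : t_equisingular F c -> malgrange F c.
Proof.
move=> equi; apply: contrapT => nmal.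
have /choice[p pP] : forall k : nat, exists p, [/\ hsurf F p, k.+2%:R < enorm p.1,
    `|p.2 - c| < k.+2%:R^-1 & enorm p.1 * enorm1 (grad_t F p) < k.+2%:R^-1].
  move=> k; apply: contrapT => np; apply: nmal.
  exists k.+2%:R, k.+2%:R^-1, k.+2%:R^-1; split; first by split; rewrite ?invr_gt0.
  move=> p Mp kp tp; rewrite leNgt; apply/negP => gp; apply: np.
  by exists p.
have x0 k : 0 < enorm (p k).1 by have [_ + _ _] := pP k; apply: lt_trans.
pose theta k := (enorm (p k).1)^-1 *: (p k).1.
have theta1 k : sphere R n (theta k).
  by rewrite /sphere /= enormZ ger0_norm ?invr_ge0 ?enorm_ge0// mulVf// gt_eqF.
have [U [UU ooU]] := ultraFilterLemma eventually_filter.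
have [u0 u01 thu] := ultra_cvg_compact UU compact_sphere theta1.
pose u : sphere R n := SigSub (mem_set u01).
have nearU (P : nat -> Prop) : (\forall k \near \oo, P k) -> \forall k \near U, P k.
  exact: ooU.
have small (e : R) : 0 < e -> \forall k \near U, k.+2%:R^-1 < e.
  move=> e0; apply: nearU; have := @near_infty_natSinv_lt R (PosNum e0).
  apply: filterS => k; apply: le_lt_trans.
  by rewrite lef_pV2 ?posrE// ler_nat.
have pcvg : at_fin (p k) @[k --> U] --> at_inf (u, c).
  apply: (@cvg_pair _ _ _ U (nbhs (inr u : sphc R n)) (nbhs c)).
    apply/cvg_sphc_inr; split; last by [].
    apply/cvgryPgt => B; have BB : \forall k \near U, B < k.+2%:R :> R.
      apply: nearU; have := nbhs_infty_gtr B.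
      by apply: filterS => k Bk; rewrite (lt_le_trans Bk)// ler_nat ltnW.
    by apply: filterS BB => k Bk; have [_ + _ _] := pP k; exact: lt_trans.
  apply/cvgrPdist_lt => e /small; apply: filterS => k ke.
  by have [_ _ + _] := pP k; rewrite distrC => /lt_trans; apply.
have Mu : Minf F (u, c).
  move=> B /pcvg UB; have [k Bk] := @filter_ex _ U _ (fun k => B (at_fin (p k))) UB.
  by exists (at_fin (p k)); split=> //; exists (p k) => //; have [] := pP k.
have dFx k : k.+1%:R * enorm (dF_x F (p k)) <= `|dF_t F (p k)| /\ dF_t F (p k) != 0.
  (* The radius being at least 1, [(k + 2) * N < |nabla F| <= N + |dF_t|]; one [N] is lost, hence
     the index shift. *)
  have [Mp xk _] := pP k; rewrite enorm1_grad_t; last exact: regF.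
  have nb0 : 0 < enorm1 (nabla F (p k)) by rewrite enorm1_gt0//; exact: regF.
  set N := enorm (dF_x F (p k)) => gk.
  have : k.+2%:R * N < enorm1 (nabla F (p k)).
    have N0 : 0 <= N by exact: enorm_ge0.
    have k0 : 0 < k.+2%:R :> R by [].
    have : 1 <= enorm (p k).1 by apply: ltW; apply: le_lt_trans xk; rewrite ler1n.
    move: gk; rewrite mulrA ltr_pdivrMr// -(ltr_pM2l k0) mulVKf ?gt_eqF//.
    move=> lt1 x1; apply: le_lt_trans lt1.
    by rewrite ler_pM2l// ler_peMl.
  have nle : enorm1 (nabla F (p k)) <= N + `|dF_t F (p k)|.
    rewrite -(ler_pXn2r (ltn0Sn 1)) ?nnegrE ?addr_ge0 ?enorm_ge0 ?enorm1_ge0//.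
    rewrite sqr_enorm1 /= -sqr_enorm -/N sqrrD real_normK ?num_real//.
    by rewrite addrAC lerDl mulrn_wge0// mulr_ge0 ?enorm_ge0.
  rewrite -natr1 mulrDl mul1r => lt1; split; first lra.
  apply/eqP => t0; move: nle lt1; rewrite t0 normr0 addr0 => nle.
  have : 0 <= k.+1%:R * N by rewrite mulr_ge0 ?enorm_ge0.
  lra.
(* The representative of the line of [nabla F] with [dt]-coefficient 1; its other coefficients tend
   to 0 by [dFx]. *)
pose xi0 k : 'rV[R]_n * R := ((dF_t F (p k))^-1 *: dF_x F (p k), 1).
have xi0_neq0 (x : 'rV[R]_n) : covec R n (x, 1).
  by apply/eqP => -[_ /eqP]; rewrite oner_eq0.
pose xi k : covec R n := SigSub (mem_set (xi0_neq0 ((dF_t F (p k))^-1 *: dF_x F (p k)))).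
pose dt : covec R n := SigSub (mem_set (xi0_neq0 0)).
have xicvg : xi k @[k --> U] --> dt.
  have h : xi0 k @[k --> U] --> ((0 : 'rV[R]_n), (1 : R)).
    apply: (@cvg_pair _ _ _ U (nbhs (0 : 'rV[R]_n)) (nbhs (1 : R))); last exact: cvg_cst.
    apply/cvgr0Pnorm_lt => e e0; have e2 : 0 < e / 2 by rewrite divr_gt0.
    have e4 : 0 < e / 4 by rewrite divr_gt0.
    apply: filterS (small _ e4) => k ke.
    have [dk tk] := dFx k; apply: (@le_lt_trans _ _ (e / 2)); last lra.
    apply: mx_norm_le => [|i]; first exact: ltW.
    rewrite mxE normrM normfV mulrC ler_pdivrMr ?normr_gt0//.
    apply: le_trans (coord_le_enorm _ i) _.
    have k1 : 1 < k.+2%:R * (e / 4) by rewrite -ltr_pdivrMl// mulr1.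
    have k2 : k.+2%:R <= 2 * k.+1%:R :> R by rewrite -natrM ler_nat; lia.
    have k3 : 1 <= e / 2 * k.+1%:R by nra.
    apply: (@le_trans _ _ (e / 2 * (k.+1%:R * enorm (dF_x F (p k))))).
      by rewrite mulrA ler_peMl ?enorm_ge0.
    by rewrite ler_pM2l.
  (* Nonzero covectors carry the subspace topology, so convergence is tested on traces of open
     sets. *)
  move=> B [B' [[C oC <-] Cdt CB]].
  have : nbhs ((0 : 'rV[R]_n), (1 : R)) C by exact: open_nbhs_nbhs.
  move=> nC; apply: (@filterS _ U _ (fun k => C (xi0 k))) => [k Ck|].
    by apply: (CB (xi k)); exact: Ck.
  exact: h.
have /seteqP[/(_ (\pi_(covec_lines R n) dt)) + _] := equi u Mu; apply; split; last first.
  rewrite /tau_conormal /= line_ker_pi; apply/seteqP; split=> w /=;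
    by rewrite /dot1 /= mul1r /dot big1 ?add0r// => i _; rewrite mxE mul0r.
split=> // B.
have ycvg : (at_fin (p k), \pi_(covec_lines R n) (xi k)) @[k --> U] -->
    (at_inf (u, c), \pi_(covec_lines R n) dt).
  apply: (@cvg_pair _ _ _ U (nbhs (at_inf (u, c))) (nbhs (\pi_(covec_lines R n) dt))) => //.
  by apply: continuous_cvg xicvg; exact: pi_continuous.
move=> /ycvg UB; have [k Bk] := @filter_ex _ U _
  (fun k => B (at_fin (p k), \pi_(covec_lines R n) (xi k))) UB.
exists (at_fin (p k), \pi_(covec_lines R n) (xi k)); split=> //.
have [Mp _ _ _] := pP k; have [_ tk] := dFx k.
exists (p k); first apply: radius_regular_dF_t => //.
  by apply: contraTneq (x0 k) => ->; rewrite enorm0 ltxx.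
(* The covector vanishes on the whole tangent space, in particular on [tangent_level]. *)
split=> // w [tw _]; rewrite line_ker_pi /=; move: tw; rewrite /tangent /= derive_nabla//.
rewrite /dot1 /= dotZl mul1r => tw.
apply/eqP; rewrite -(mulrI_eq0 _ (mulfI tk)) mulrDr mulVKf//; exact/eqP.
Qed.

End malgrange_condition.

Theorem corollary5p2 (R : realType) (S : omin_structure R)
    (S_pb : polynomially_bounded S) (n m : nat) (n_ge1 : (1 <= n)%N)
    (F : 'rV[R]_n * R -> R) (F_def : globally_definable_fun S F)
    (F_cls : of_class (2 + m)%N F) (F_reg : regular_value_of F 0) :
  (forall c : R, values_t F c -> ~ K F c -> horizontally_spherical F c) /\
  (forall c : R, values_t F c -> ~ K0 F c -> t_equisingular F c ->
     horizontally_spherical F c).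
Proof.
have [diffF diffDF] := F_cls.
have contDF v : continuous ('D_v F).
  by have [dDF _] := diffDF v; move=> p; exact: differentiable_continuous.
split=> c _ cK.
  apply: (malgrange_horizontally_spherical diffF F_reg F_def contDF).
  by apply: contrapT => nmal; apply: cK; right.
move=> /(t_equisingular_malgrange diffF F_reg).
exact: malgrange_horizontally_spherical F_def contDF.
Qed.
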